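(* Let $d\ge 2$ be an integer. There exists $n_0=n_0(d)$ such that the following holds for all $n>n_0$. Let $G$ be a $d$-regular graph of size $|G|=n$ whose mixing time satisfies $$\mathfrak m(G)\le \frac{\log^2(n)}{(\log\log (n))^5}.$$ Let $\{A_t\}_{t\ge 0}$ be a $G$-Cylinder-DLA process and, for $m\in\mathbb N$, let $T_m=\min\{t\ge 0 : A_t\cap G_m\ne\emptyset\}$ be the time the cluster first reaches layer $m$. Then for all $m\ge 1$, $$\mathbf E[T_m]<\frac{4mn}{\log\log n}.$$
   Context: Graphs $G$ are finite, simple and connected; $|G|$ is the number of vertices, and $v\in G$ means $v\in V(G)$. $\mathbb N=\{0,1,2,\dots\}$; $\log$ is the natural logarithm. Mixing time: let $(g'_t)_{t\ge0}$ be the lazy random walk on $G$ which at each step chooses uniformly among the current vertex and its $d$ neighbours. Then $\mathfrak m(G)=\min\{t>0: \forall u,v\in G,\ \forall s\ge t,\ \Pr[g'_s=u\mid g'_0=v]\ge \frac1{2|G|}\}$. Cylinder: $G\times\mathbb N$ has vertex set $V(G)\times\mathbb N$, with $(u,m)\sim(v,k)$ iff either $m=k$ and $u\sim v$, or $|m-k|=1$ and $u=v$. The $i$-th layer is $G_i=V(G)\times\{i\}$. For a set $A$ of vertices of $G\times\mathbb N$, $\partial A$ is the set of vertices not in $A$ that are adjacent to some vertex of $A$. $G$-Cylinder-DLA process: a random increasing sequence $(A_t)_{t\ge 0}$ of vertex sets with $A_0=G_0$. Given $A_0,\dots,A_t$, put $M(t)=\min\{i\in\mathbb N: G_i\cap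 A_t=\emptyset\}$ and let $(g_{t+1}(r),\zeta_{t+1}(r))_{r\ge0}$ be a simple random walk on $G\times\mathbb N$ (each step goes to a uniformly random neighbour) with $g_{t+1}(0)$ uniform on $V(G)$ and $\zeta_{t+1}(0)=M(t)$. Let $\kappa(t+1)=\min\{r\ge0:(g_{t+1}(r),\zeta_{t+1}(r))\in\partial A_t\}$ (a.s. finite) and $A_{t+1}=A_t\cup\{(g_{t+1}(\kappa(t+1)),\zeta_{t+1}(\kappa(t+1)))\}$. *)

(* Defs.v *)
From HB Require Import structures.
From mathcomp Require Export all_boot all_order all_algebra.
From mathcomp Require Export finmap.
From mathcomp Require Export all_classical all_reals all_analysis.

Set Implicit Arguments.
Unset Strict Implicit.
Unset Printing Implicit Defensive.

Import Order.TTheory GRing.Theory Num.Theory.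

Local Open Scope classical_set_scope.
Local Open Scope ring_scope.

Definition simple_graph (V : finType) (e : rel V) : Prop :=
  symmetric e /\ irreflexive e.

Definition connected_graph (V : finType) (e : rel V) : Prop :=
  forall u v : V, connect e u v.

Definition regular_graph (V : finType) (e : rel V) (d : nat) : Prop :=
  forall v : V, #|[set u | e v u]%SET| = d.

(* The minimum of a set of naturals as an extended real, +oo for the empty
   set. *)
Definition first_time (R : realType) (S : set nat) : \bar R :=
  ereal_inf [set (t%:R)%:E | t in S].

(* The probability of stepping from x to y when the next position is uniform
   among the z with adj x z. Here [fset_set] sends infinite sets to the empty
   set; it is only used for relations with finitely many z for each x. *)
Definition uniform_step (R : realType) (T : choiceType) (adj : rel T)
    (x y : T) : R :=
  if adj x y then (#|` fset_set [set z | adj x z]|)%:R^-1 else 0.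

Definition lazy_step (R : realType) (V : finType) (e : rel V) : V -> V -> R :=
  uniform_step R (fun u v => (u == v) || e u v).

(* Pr[g'_s = u | g'_0 = v]. *)
Fixpoint lazy_prob (R : realType) (V : finType) (e : rel V) (s : nat)
    (v u : V) : R :=
  if s is s'.+1 then \sum_(z : V) lazy_step R e v z * lazy_prob R e s' z u
  else (v == u)%:R.

Definition mixing_time (R : realType) (V : finType) (e : rel V) : \bar R :=
  first_time R [set t | (0 < t)%N /\
    forall (u v : V) (s : nat), (t <= s)%N ->
      (2 * #|V|%:R)^-1 <= lazy_prob R e s v u].

Definition cyl_adj (V : finType) (e : rel V) : rel (V * nat) :=
  fun x y => ((x.2 == y.2) && e x.1 y.1)
          || (((x.2 == y.2.+1) || (y.2 == x.2.+1)) && (x.1 == y.1)).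

Definition layer (V : finType) (i : nat) : {fset V * nat} :=
  [fset (v, i) | v in V]%fset.

Definition boundary (V : finType) (e : rel V) (A : {fset V * nat})
    : set (V * nat) :=
  [set y | y \notin A /\ exists2 x, x \in A & cyl_adj e x y].

Lemma exists_empty_layer (V : finType) (A : {fset V * nat}) :
  exists i, (layer V i `&` A == fset0)%fset.
Proof.
exists (\max_(x <- A) x.2).+1; apply/eqP/fsetP => x.
rewrite !inE; apply/negP => /andP[/imfsetP[v _ ->] xA].
by have := @leq_bigmax_seq _ (enum_fset A) xpredT snd _ xA isT; rewrite /= ltnn.
Qed.

(* M(t) as a function of the cluster A_t. *)
Definition first_empty_layer (V : finType) (A : {fset V * nat}) : nat :=
  ex_minn (exists_empty_layer A).

(* The probability that a simple random walk on the cylinder, started from a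
   uniform vertex of layer i, has x 0, ..., x k as its first k + 1 positions. *)
Definition walk_law (R : realType) (V : finType) (e : rel V) (i k : nat)
    (x : nat -> V * nat) : R :=
  (if (x 0%N).2 == i then #|V|%:R^-1 else 0) *
  \prod_(r < k) uniform_step R (cyl_adj e) (x r) (x r.+1).

(* r is the hitting time kappa of the boundary of A by the trajectory x. *)
Definition is_hitting_time (V : finType) (e : rel V) (A : {fset V * nat})
    (x : nat -> V * nat) (r : nat) : Prop :=
  boundary e A (x r) /\ forall s, (s < r)%N -> ~ boundary e A (x s).

(* A t w is the cluster at time t, and X t.+1 r w the position after r steps of
   the walk released at time t (X 0 plays no role). The conditional law of the
   walk given A 0, ..., A t is stated in product form. On the null event that
   the walk never hits the boundary, A t.+1 is only required to contain A t. *)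
Record cylinder_DLA (R : realType) (d : measure_display) (Omega : measurableType d)
    (P : probability Omega R) (V : finType) (e : rel V)
    (A : nat -> Omega -> {fset V * nat})
    (X : nat -> nat -> Omega -> V * nat) : Prop := CylinderDLA {
  cdla_measurable_cluster : forall t a, measurable [set w | A t w = a];
  cdla_measurable_walk : forall t r x, measurable [set w | X t r w = x];
  cdla_init : forall w, A 0%N w = layer V 0;
  cdla_increasing : forall t w, (A t w `<=` A t.+1 w)%fset;
  cdla_walk : forall (t : nat) (a : nat -> {fset V * nat})
      (k : nat) (x : nat -> V * nat),
    P [set w | (forall s, (s <= t)%N -> A s w = a s) /\
               (forall r, (r <= k)%N -> X t.+1 r w = x r)] =
    (P [set w | forall s, (s <= t)%N -> A s w = a s] *
     (walk_law R e (first_empty_layer (a t)) k x)%:E)%E;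
  cdla_step : forall t w r,
    is_hitting_time e (A t w) (fun r' => X t.+1 r' w) r ->
    A t.+1 w = (X t.+1 r w |` A t w)%fset
}.

(* T_m, equal to +oo if layer m is never reached. *)
Definition layer_time (R : realType) (Omega : Type) (V : finType)
    (A : nat -> Omega -> {fset V * nat}) (m : nat) (w : Omega) : \bar R :=
  first_time R [set t | (A t w `&` layer V m)%fset <> fset0].

(* Main.v *)
(* Let M be the lowest empty layer, n = |G|, y = log log n, q ~ log^2 n and
   L ~ log n / (4 y). Let k be the smallest depth, 1 <= k <= L, such that
   at least q^k particles of the cluster lie in layers >= M - k.

   If k exists, layer M - k holds at least q^k / 2 particles. A walk released uniformly
   in layer M has a uniform horizontal position when it first visits layer
   M - k + 1, so with probability at least q^k / (2 n) it sticks there or higher.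
   Fewer than q^(k-1) particles are needed to leave this situation, which thus
   costs O(n / q) time for each k, hence O(n L / q) = o(n / y) in total; for
   k = 1 the new particle opens layer M.

   If no such k exists, the top L layers are almost empty. By symmetry of the
   walk, the probability to stick at a site v of layer M above the cluster is
   1 / n times the expected number of visits to layer M of a walk started
   at v, before it meets the cluster again. From v the walk climbs to
   height H with H^2 of the order of the mixing time with probability of order
   1 / H, and it then returns mixed to layer M, which it visits of order L times
   before reaching depth L. The bound on the mixing time is what makes
   L / H >= 16 y, so that layer M is opened with probability y / (2 n) at least.

   Both cases combine into one Lyapunov function, [potential]. All hitting
   probabilities are bounded below by strict subsolutions of the discrete
   equations, which are dominated after finitely many steps. *)
Require Import Defs.
From mathcomp Require Import measurable_realfun ring lra zify.
Import Order.TTheory GRing.Theory Num.Theory.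
Local Open Scope ring_scope.

Set Implicit Arguments.
Unset Strict Implicit.
Unset Printing Implicit Defensive.

(* The defect [phi - y k] is at most [C - delta * k]: it shrinks by [delta] at
   each step, so that no limit has to be taken. *)
Lemma strict_subsolution_le (R : realType) (X : Type) (phi : X -> R)
    (y : nat -> X -> R) (C delta : R) :
  0 < delta ->
  (forall k x, 0 <= y k x) -> (forall x, phi x <= C) ->
  (forall k c x, 0 <= c -> (forall z, phi z - c <= y k z) -> 0 < phi x ->
     phi x <= y k.+1 x \/ phi x - c + delta <= y k.+1 x) ->
  exists k, forall x, phi x <= y k x.
Proof.
move=> d0 y0 phiC step.
pose c k : R := Num.max 0 (C - delta * k%:R).
have main k x : phi x - c k <= y k x.
  elim: k x => [|k IH] x.
    rewrite /c mulr0 subr0 (le_trans _ (y0 _ _))// subr_le0.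
    by rewrite le_max phiC orbT.
  have [px|px] := leP (phi x) 0.
    rewrite (le_trans _ (y0 _ _))// subr_le0 (le_trans px)//.
    by rewrite le_max lexx.
  have c0 : 0 <= c k by rewrite le_max lexx.
  have ck0 : 0 <= c k.+1 by rewrite le_max lexx.
  have ckd : c k - delta <= c k.+1.
    rewrite lerBlDr /c ge_max; apply/andP; split; first by rewrite addr_ge0// ltW.
    by rewrite -lerBlDr le_max; apply/orP; right; rewrite mulrSr mulrDr mulr1; lra.
  by case: (step k (c k) x c0 IH px); lra.
have p1 : 0 < `|C| / delta + 1 by rewrite ltr_wpDl// divr_ge0// ltW.
exists (Num.Def.archi_bound (`|C| / delta + 1)) => x.
have := archi_boundP (ltW p1); set k := Num.Def.archi_bound _ => kH.
have := main k x; suff -> : c k = 0 by rewrite subr0.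
apply/max_idPl; rewrite subr_le0 (le_trans (ler_norm C))//.
rewrite mulrC -ler_pdivrMr// (le_trans _ (ltW kH))//; lra.
Qed.

(** * Recurrence of the vertical coordinate *)

Section recurrence.
Variables (R : realType) (D : R).
Hypothesis D0 : 0 <= D.

(* Strict subsolution for the probability to reach 0 before [H] from [i]. *)
Definition parabola (H i : nat) : R :=
  if (i <= H)%N then 1 - i%:R * (2 * H%:R + 1 - i%:R) / H%:R ^+ 2 else 0.

Lemma parabola_le1 H i : parabola H i <= 1.
Proof.
rewrite /parabola; case: ifPn => // iH; rewrite gerBl.
have : i%:R <= H%:R :> R by rewrite ler_nat.
move=> h; apply: mulr_ge0; last by rewrite invr_ge0 exprn_ge0.
by apply: mulr_ge0 => //; have := ler0n R i; lra.
Qed.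

(** The summand 1 in [2 * H + 1 - i] makes the value at [H] equal to [-1 / H]. Positivity thus ends
    strictly below [H], and [parabola_step] never meets the truncated values. *)
Lemma parabola_gt0_lt H i : (0 < H)%N -> 0 < parabola H i -> (i < H)%N.
Proof.
move=> H0; rewrite /parabola; case: ifPn => [|_]; last by rewrite ltxx.
rewrite leq_eqVlt => /orP[/eqP ->|//].
have HR : 0 < H%:R :> R by rewrite ltr0n.
rewrite subr_gt0 ltr_pdivrMr ?exprn_gt0// mul1r expr2 ltr_pM2l//; lra.
Qed.

Lemma parabola_step H i : (0 < i)%N -> (i < H)%N ->
  parabola H i.+1 + parabola H i.-1 = 2 * parabola H i + 2 / H%:R ^+ 2.
Proof.
case: i => // i _ iH; rewrite /parabola iH (ltnW iH) (ltnW (ltnW iH)) /=.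
have HR : H%:R != 0 :> R by rewrite pnatr_eq0 -lt0n (leq_trans _ iH).
by rewrite -!natr1; field.
Qed.

(** A one-dimensional walk with holding weight [D] is recurrent, so the chance of having reached 0
    tends to 1; [parabola h] bounds it from below. *)
Lemma recurrent_average (y : nat -> nat -> R) :
  (forall k i, 0 <= y k i) -> (forall k, 1 <= y k 0%N) ->
  (forall k i, (0 < i)%N ->
     D * y k i + y k i.+1 + y k i.-1 <= (D + 2) * y k.+1 i) ->
  forall (i : nat) (eps : R), 0 < eps -> exists k, 1 - eps <= y k i.
Proof.
move=> y0 y1 ystep i eps eps0.
have [e1|e1] := ltP 1 eps.
  by exists 0%N; apply: le_trans (y0 _ _); rewrite subr_le0 ltW.
(* At [i] the parabola of width [h] is at least [1 - 3 * i.+1 / h]. *)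
pose h := Num.Def.archi_bound ((3 * i.+1%:R) / eps).
have hP : (3 * i.+1%:R) / eps < h%:R.
  by apply: archi_boundP; rewrite divr_ge0// ?ltW// mulr_ge0.
have h0 : 0 < h%:R :> R.
  by apply: le_lt_trans hP; rewrite divr_ge0// ?ltW// mulr_ge0.
have h0' : (0 < h)%N by rewrite -(ltr0n R).
have i1 : i.+1%:R < eps * h%:R / 3 by move: hP; rewrite ltr_pdivrMr//; lra.
have ih : (i <= h)%N.
  rewrite -(ler_nat R); have := ler_wpM2r (ltW h0) e1.
  by move: i1; rewrite -natr1; lra.
have hne : h%:R != 0 :> R by rewrite gt_eqF.
have [k kP] : exists k, forall x, parabola h x <= y k x; last first.
  exists k; apply: le_trans (kP i).
  rewrite /parabola ih lerD2l lerN2 ler_pdivrMr ?exprn_gt0//.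
  rewrite expr2 mulrA; apply: (@le_trans _ _ (i.+1%:R * (3 * h%:R))); last first.
    have q : i.+1%:R * 3 <= eps * h%:R by move: i1; lra.
    by have := ler_wpM2r (ltW h0) q; rewrite mulrA.
  have : 1 <= h%:R :> R by rewrite ler1n.
  have : 0 <= i%:R :> R by [].
  by rewrite -natr1 => a b; nra.
apply: (strict_subsolution_le (C := 1) (delta := 2 / h%:R ^+ 2 / (D + 2)))
  => [|k||k c j c0 IH pj].
- by rewrite divr_gt0// ?divr_gt0// ?exprn_gt0//; have := D0; lra.
- exact: y0.
- exact: parabola_le1.
- have jh := parabola_gt0_lt h0' pj.
  case: j jh pj => [|j] jh pj.
    by left; rewrite (le_trans (parabola_le1 _ _)).
  right; have := ystep k j.+1 isT => /=.
  have := parabola_step (isT : (0 < j.+1)%N) jh => /=.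
  have := ler_wpM2l D0 (IH j.+1); have := IH j.+2; have := IH j.
  have D2 : 0 < D + 2 by have := D0; lra.
  move=> a1 a2 a3 a4 a5; rewrite -(ler_pM2l D2).
  by rewrite mulrDr [_ * (2 / _ / _)]mulrC divfK ?gt_eqF//; lra.
Qed.
End recurrence.

(** * Averages, hitting probabilities and Green functions on the cylinder *)

Section cylinder_walk.
Variables (R : realType) (V : finType) (e : rel V) (d : nat).
Hypothesis e_sym : symmetric e.
Hypothesis e_reg : regular_graph e d.

(** One step of the simple random walk, but only for [0 < i]: at layer 0 the predecessor is
    truncated. Hence [hit_prob] treats layer 0 apart, and [green_adjoint] asks that [alive] exclude
    it. *)
Definition walk_avg (f : V -> nat -> R) (v : V) (i : nat) : R :=
  (\sum_(u | e v u) f u i + f v i.+1 + f v i.-1) / (d%:R + 2).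

Let d2_gt0 : 0 < d%:R + 2 :> R.
Proof. by have := ler0n R d; lra. Qed.

Lemma card_nbrs v : #|[pred u | e v u]| = d.
Proof. by rewrite -(e_reg v); apply: eq_card => u; rewrite !inE. Qed.

Lemma walk_avg_cst c v i : walk_avg (fun _ _ => c) v i = c.
Proof.
rewrite /walk_avg sumr_const card_nbrs -mulr_natl.
by field; rewrite gt_eqF.
Qed.

Lemma le_walk_avg f g v i :
  (forall u, e v u -> f u i <= g u i) -> f v i.+1 <= g v i.+1 ->
  f v i.-1 <= g v i.-1 -> walk_avg f v i <= walk_avg g v i.
Proof.
move=> h1 h2 h3; rewrite ler_pM2r ?invr_gt0// !lerD//.
by apply: ler_sum => u /h1.
Qed.

Lemma walk_avg_ge0 f v i : (forall u j, 0 <= f u j) -> 0 <= walk_avg f v i.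
Proof.
by move=> f0; rewrite -(walk_avg_cst 0 v i); apply: le_walk_avg.
Qed.

Lemma eq_walk_avg f g v i : (forall u j, f u j = g u j) ->
  walk_avg f v i = walk_avg g v i.
Proof. by move=> fg; apply: le_anti; rewrite !le_walk_avg// => *; rewrite fg. Qed.

Lemma walk_avgD f g v i :
  walk_avg (fun u j => f u j + g u j) v i = walk_avg f v i + walk_avg g v i.
Proof. by rewrite /walk_avg big_split/=; lra. Qed.

Lemma sum_nbrs (f : V -> V -> R) :
  \sum_v \sum_(u | e v u) f v u = \sum_u \sum_(v | e u v) f v u.
Proof.
by rewrite (exchange_big_dep xpredT)//=; apply: eq_bigr => u _;
  apply: eq_bigl => v; rewrite e_sym.
Qed.

Lemma sum_walk_avg f i :
  \sum_v walk_avg f v i = (d%:R * (\sum_v f v i) + \sum_v f v i.+1 +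
                           \sum_v f v i.-1) / (d%:R + 2).
Proof.
rewrite -mulr_suml !big_split/= sum_nbrs mulr_sumr; congr ((_ + _ + _) / _).
by apply: eq_bigr => u _; rewrite sumr_const card_nbrs mulr_natl.
Qed.

(** The kernel is symmetric: horizontally because [e] is, vertically by a shift of the index.
    Vanishing on layer 0 and from [N] on removes the boundary terms. *)
Lemma walk_avg_adjoint N (f g : V -> nat -> R) :
  (forall v i, (i == 0%N) || (N <= i)%N -> f v i = 0) ->
  (forall v i, (i == 0%N) || (N <= i)%N -> g v i = 0) ->
  \sum_(i < N) \sum_v walk_avg f v i * g v i =
  \sum_(i < N) \sum_v f v i * walk_avg g v i.
Proof.
move=> f0 g0.
have shift (F G : V -> nat -> R) : (forall v i, (i == 0%N) || (N <= i)%N -> F v i = 0) ->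
  (forall v i, (i == 0%N) || (N <= i)%N -> G v i = 0) ->
  \sum_(i < N) \sum_v F v i.+1 * G v i = \sum_(i < N) \sum_v F v i * G v i.-1 :> R.
  move=> F0 G0.
  rewrite -(big_mkord xpredT (fun i => \sum_v F v i.+1 * G v i)).
  rewrite -(big_mkord xpredT (fun i => \sum_v F v i * G v i.-1)).
  transitivity (\sum_(0 <= i < N.+1) \sum_v F v i * G v i.-1).
    rewrite big_nat_recl// [X in _ = X + _]big1 ?add0r// => v _.
    by rewrite F0// mul0r.
  rewrite big_nat_recr//= [X in _ + X]big1 ?addr0// => v _.
  by rewrite F0 ?mul0r// leqnn orbT.
rewrite /walk_avg.
under eq_bigr do under eq_bigr do rewrite mulrAC.
under [RHS]eq_bigr do under eq_bigr do rewrite mulrA.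
under eq_bigr do rewrite -mulr_suml.
under [RHS]eq_bigr do rewrite -mulr_suml.
rewrite -!mulr_suml; congr (_ / _).
under eq_bigr do under eq_bigr do rewrite !mulrDl.
under [RHS]eq_bigr do under eq_bigr do rewrite !mulrDr.
under eq_bigr do rewrite !big_split/=.
under [RHS]eq_bigr do rewrite !big_split/=.
rewrite !big_split/= -!addrA; congr (_ + _).
  apply: eq_bigr => i _.
  under eq_bigr do rewrite mulr_suml.
  rewrite sum_nbrs; apply: eq_bigr => v _; rewrite mulr_sumr.
  by apply: eq_bigr.
rewrite (shift f g)// addrC; congr (_ + _).
transitivity (\sum_(i < N) \sum_v g v i * f v i.-1).
  by apply: eq_bigr => i _; apply: eq_bigr => v _; rewrite mulrC.
rewrite -(shift g f)//.
by apply: eq_bigr => i _; apply: eq_bigr => v _; rewrite mulrC.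
Qed.

Section hitting.
Variables stop target : V -> nat -> bool.

(** Probability that within [k] steps the walk meets [stop], for the first time at a [target]
    vertex. Paths reaching an unstopped vertex of layer 0 are discarded, which only lowers the
    value. *)
Fixpoint hit_prob (k : nat) (v : V) (i : nat) : R :=
  if stop v i then (target v i)%:R
  else if k is k'.+1 then if i == 0%N then 0 else walk_avg (hit_prob k') v i
  else 0.

Lemma hit_prob_stop k v i : stop v i -> hit_prob k v i = (target v i)%:R.
Proof. by case: k => [|k] /= ->. Qed.

Lemma hit_prob_ge0 k v i : 0 <= hit_prob k v i.
Proof.
elim: k v i => [|k IH] v i /=; case: ifP => //= _; first by case: ifP => // _; exact: walk_avg_ge0.
Qed.

Lemma hit_prob_le1 k v i : hit_prob k v i <= 1.
Proof.
elim: k v i => [|k IH] v i /=; case: ifP => _; rewrite ?lern1 ?leq_b1//.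
by case: ifP => // _; rewrite -(walk_avg_cst 1 v i); apply: le_walk_avg.
Qed.

(* The layers are crossed one at a time and the horizontal position stays
   uniform, so the first visited vertex of layer j is uniform. *)
Lemma hit_prob_layer j i (eps : R) : (0 < j <= i)%N -> 0 < eps ->
  (forall v i', (j <= i')%N -> stop v i' -> target v i') ->
  exists k, (1 - eps) * #|[pred v | stop v j]|%:R <= \sum_v hit_prob k v i.
Proof.
move=> /andP[j0 ji] eps0 st; set c := #|_|.
have [->|c0] := posnP c.
  by exists 0%N; rewrite mulr0 sumr_ge0// => v _; exact: hit_prob_ge0.
have cR : 0 < c%:R :> R by rewrite ltr0n.
(* Divided by [c], the sum over layer [j + h] is at least 1 for [h = 0], since the [c] stopped
   vertices of layer [j] are targets. *)
have [k kP] : exists k, 1 - eps <= (\sum_v hit_prob k v (j + (i - j))%N) / c%:R.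
  apply: (recurrent_average (D := d%:R) (ler0n _ _)
    (y := fun k h => (\sum_v hit_prob k v (j + h)%N) / c%:R)) => // [k h|k|k h h0].
  - by rewrite divr_ge0// sumr_ge0// => v _; exact: hit_prob_ge0.
  - rewrite addn0 ler_pdivlMr// mul1r (bigID (fun v => stop v j))/= ler_wpDr//.
      by rewrite sumr_ge0// => v _; exact: hit_prob_ge0.
    rewrite (eq_bigr (fun=> 1)) ?sumr_const// => v vj.
    by rewrite hit_prob_stop// st.
  - case: h h0 => // h _; rewrite /= addnS mulrA -!mulrDl mulrA.
    rewrite ler_pM2r ?invr_gt0// -ler_pdivrMl// mulrC -addnS.
    apply: (@le_trans _ _ (\sum_v walk_avg (hit_prob k) v (j + h.+1))).
      by rewrite sum_walk_avg !addnS /=.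
    (* A stopped vertex above layer [j] is a target, so its value 1 dominates the average. *)
    apply: ler_sum => v _ /=; case: ifP => [sv|_]; last by rewrite addnS.
    rewrite st// ?leq_addr// -(walk_avg_cst 1 v (j + h.+1)).
    by apply: le_walk_avg => *; exact: hit_prob_le1.
by exists k; move: kP; rewrite ler_pdivlMr// subnKC.
Qed.

End hitting.

Section green.
Variable alive : V -> nat -> bool.

(** Expected total of [b] over the first [k] positions, the start included, of the walk killed on
    leaving [alive]. *)
Fixpoint green (b : V -> nat -> R) (k : nat) (v : V) (i : nat) : R :=
  if k is k'.+1 then
    if alive v i then b v i + walk_avg (green b k') v i else 0
  else 0.

Lemma green_dead b k v i : ~~ alive v i -> green b k v i = 0.
Proof. by case: k => //= k /negbTE ->. Qed.

Lemma green_ge0 b k v i : (forall u j, 0 <= b u j) -> 0 <= green b k v i.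
Proof.
move=> b0; elim: k v i => //= k IH v i; case: ifP => // _.
by rewrite addr_ge0// walk_avg_ge0.
Qed.

Lemma le_green b k l v i : (forall u j, 0 <= b u j) -> (k <= l)%N ->
  green b k v i <= green b l v i.
Proof.
move=> b0; elim: k l v i => [|k IH] l v i kl; first exact: green_ge0.
case: l kl => // l kl /=; case: ifP => // _.
by rewrite lerD2l le_walk_avg// => *; exact: IH.
Qed.

(** Unrolls the powers of the killed kernel from the far end; transposition reverses the order of
    the factors, so [green_adjoint] needs both recursions. *)
Lemma green_recl b k v i :
  green b k.+1 v i =
  (if alive v i then b v i else 0) +
  green (fun u j => walk_avg (fun w l => if alive w l then b w l else 0) u j) k v i.
Proof.
elim: k v i => [|k IH] v i.
  by rewrite /= addr0; case: ifP => // _; rewrite walk_avg_cst addr0.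
rewrite [LHS]/= (eq_walk_avg _ _ IH) walk_avgD /=.
by case: ifP => _; rewrite ?addr0// addrA.
Qed.

Lemma green_adjoint N (a b : V -> nat -> R) k :
  (forall v i, alive v i -> (0 < i < N)%N) ->
  \sum_(i < N) \sum_(v | alive v i) green a k v i * b v i =
  \sum_(i < N) \sum_(v | alive v i) a v i * green b k v i.
Proof.
move=> aN; elim: k b => [|k IH] b.
  rewrite !big1// => i _; rewrite big1// => v _; rewrite /= ?mulr0 ?mul0r//.
have aN0 v i : (i == 0%N) || (N <= i)%N -> alive v i = false.
  move=> h; apply/negbTE/negP => /aN /andP[i0 iN].
  by move: h; rewrite leqNgt iN orbF => /eqP i00; rewrite i00 in i0.
pose b' v i := if alive v i then b v i else 0.
transitivity (\sum_(i < N) \sum_(v | alive v i) a v i * b v i +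
  \sum_(i < N) \sum_(v | alive v i) green a k v i * walk_avg b' v i).
  transitivity (\sum_(i < N) \sum_(v | alive v i) a v i * b v i +
     \sum_(i < N) \sum_v walk_avg (green a k) v i * b' v i).
    rewrite -big_split/=; apply: eq_bigr => i _.
    rewrite [X in _ = _ + X](bigID (fun v => alive v i))/= [X in _ = _ + (_ + X)]big1.
      rewrite addr0 -big_split/=; apply: eq_bigr => v av.
      by rewrite /b' av mulrDl.
    by move=> v /negbTE av; rewrite /b' av mulr0.
  congr (_ + _); rewrite walk_avg_adjoint//.
    apply: eq_bigr => i _; rewrite [LHS](bigID (fun v => alive v i))/=.
    by rewrite [X in _ + X]big1 ?addr0// => v av; rewrite green_dead// mul0r.
  - by move=> v i /aN0 av; rewrite green_dead// av.
  - by move=> v i /aN0 av; rewrite /b' av.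
rewrite IH -big_split/=; apply: eq_bigr => i _; rewrite -big_split/=.
by apply: eq_bigr => v av; have := green_recl b k v i; rewrite /= av => ->; rewrite mulrDr.
Qed.

End green.
End cylinder_walk.

(** * Mean number of visits to layer M of a walk started on it *)

Definition tent (M L i : nat) : nat := (L - ((i - M) + (M - i)))%N.

Lemma tent_peak M L : (0 < L <= M)%N ->
  [/\ tent M L M = L, tent M L M.+1 = L.-1 & tent M L M.-1 = L.-1].
Proof. by rewrite /tent => LM; split; lia. Qed.

Lemma tent_slope M L i : (L <= M)%N -> (0 < tent M L i)%N -> i != M ->
  (tent M L i.+1 = (tent M L i).+1 /\ tent M L i.-1 = (tent M L i).-1) \/
  (tent M L i.+1 = (tent M L i).-1 /\ tent M L i.-1 = (tent M L i).+1).
Proof. by rewrite /tent => LM t0 iM; lia. Qed.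

Lemma tent_range M L i : (0 < tent M L i)%N -> (M < i + L)%N /\ (i < M + L)%N.
Proof. by rewrite /tent => t0; split; lia. Qed.

Section green_layer.
Variables (R : realType) (V : finType) (e : rel V) (d : nat).
Hypothesis e_sym : symmetric e.
Hypothesis e_reg : regular_graph e d.
Variables (alive : V -> nat -> bool) (M L K : nat).
Hypothesis L_gt0 : (0 < L)%N.
Hypothesis L_leM : (L <= M)%N.
Hypothesis alive_range : forall v i, alive v i -> (M < i + L)%N && (i < M + L)%N.
Hypothesis card_dead : forall i, (M < i + L)%N -> (i < M + L)%N ->
  (#|[pred v | ~~ alive v i]| <= K)%N.
Hypothesis K_small : 8 * (d%:R + 2) * L%:R ^+ 2 * K%:R <= #|V|%:R :> R.
Hypothesis V_gt0 : (0 < #|V|)%N.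

Definition layer_source (v : V) (i : nat) : R := (i == M)%:R.

Local Notation psi := (green e d alive layer_source).
Local Notation wavg := (walk_avg e d).

Let d2_gt0 : 0 < d%:R + 2 :> R.
Proof. by have := ler0n R d; lra. Qed.

Let le_of_eq (x y : R) : x = y -> x <= y.
Proof. by move=> ->. Qed.

Let scaled_average (s m mp mm : R) : s + mp + mm <= 2 * m ->
  s + (d%:R * ((d%:R + 2) * m) + (d%:R + 2) * mp + (d%:R + 2) * mm) / (d%:R + 2)
  <= (d%:R + 2) * m.
Proof.
have -> : (d%:R * ((d%:R + 2) * m) + (d%:R + 2) * mp + (d%:R + 2) * mm) /
  (d%:R + 2) = d%:R * m + mp + mm by field; rewrite gt_eqF.
by rewrite mulrDl; lra.
Qed.

Lemma walk_avg_layer (c : nat -> R) v i :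
  wavg (fun _ j => c j) v i = (d%:R * c i + c i.+1 + c i.-1) / (d%:R + 2).
Proof. by rewrite /walk_avg sumr_const (card_nbrs e_reg) mulr_natl. Qed.

(* The bound is the Green function of the walk killed below layer M - L. *)
Lemma green_layer_le k v i :
  psi k v i <= (d%:R + 2) * (minn (i - (M - L)) L)%:R.
Proof.
elim: k v i => [|k IH] v i /=; first by rewrite mulr_ge0// ltW.
case: ifP => [/alive_range/andP[iM _]|_]; last by rewrite mulr_ge0// ltW.
pose U j : R := (d%:R + 2) * (minn (j - (M - L)) L)%:R.
apply: (@le_trans _ _ (layer_source v i + wavg (fun _ j => U j) v i)).
  by rewrite lerD2l le_walk_avg.
rewrite walk_avg_layer; apply: scaled_average.
by rewrite /layer_source -!natrD -natrM ler_nat; case: eqP => h; lia.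
Qed.

Lemma source_walk_avg_le k v i : (M < i + L)%N ->
  layer_source v i + wavg (psi k) v i <= (d%:R + 2) * L%:R.
Proof.
move=> iM.
pose U j : R := (d%:R + 2) * (minn (j - (M - L)) L)%:R.
apply: (@le_trans _ _ (layer_source v i + wavg (fun _ j => U j) v i)).
  by rewrite lerD2l le_walk_avg// => *; exact: green_layer_le.
apply: (@le_trans _ _ (U i)); last first.
  by rewrite ler_wpM2l ?(ltW d2_gt0)// ler_nat geq_minr.
rewrite walk_avg_layer; apply: scaled_average.
by rewrite /layer_source -!natrD -natrM ler_nat; case: eqP => h; lia.
Qed.

(** Compared with the free walk, each of the at most [K] dead vertices loses at most [(d + 2) * L],
    by [source_walk_avg_le]. *)
Lemma sum_green_layer_step k i : (M < i + L)%N -> (i < M + L)%N ->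
  (i == M)%:R * #|V|%:R + (d%:R * (\sum_v psi k v i) + \sum_v psi k v i.+1 +
    \sum_v psi k v i.-1) / (d%:R + 2) - (d%:R + 2) * L%:R * K%:R
  <= \sum_v psi k.+1 v i.
Proof.
move=> iM Mi; rewrite -(sum_walk_avg e_sym e_reg).
have -> : (i == M)%:R * #|V|%:R = \sum_(v : V) layer_source v i.
  by rewrite /layer_source sumr_const mulr_natr.
rewrite -big_split/= (bigID (fun v => alive v i)) /=.
rewrite [X in _ <= X](bigID (fun v => alive v i)) /= -addrA lerD//.
  by apply: ler_sum => v ->.
rewrite [X in _ <= X]big1 => [|v /negbTE ->//].
rewrite subr_le0 (le_trans (ler_sum _ (fun v _ => source_walk_avg_le k v iM)))//.
rewrite sumr_const -[X in X <= _]mulr_natr ler_wpM2l ?mulr_ge0 ?(ltW d2_gt0)//.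
by rewrite ler_nat; apply: leq_trans (card_dead iM Mi); apply: eq_leq; apply: eq_card.
Qed.

Lemma sum_green_layer :
  exists k, (d%:R + 2) * #|V|%:R * L%:R / 8 <= \sum_v psi k v M.
Proof.
pose t := tent M L.
have [tM tMS tMP] : [/\ t M = L, t M.+1 = L.-1 & t M.-1 = L.-1].
  by apply: tent_peak; rewrite L_gt0.
have LR : 0 < L%:R :> R by rewrite ltr0n.
have nR : 0 < #|V|%:R :> R by rewrite ltr0n.
(* [K_small] bounds the loss to dead vertices by this [a]. At the peak, the kink, that loss and the
   gain [delta = a] cost [4 * a * L] in all, half of the source [#|V| = 8 * a * L]. *)
pose a : R := #|V|%:R / (8 * L%:R).
have a0 : 0 < a by rewrite divr_gt0// mulr_gt0.
have aL : a * L%:R = #|V|%:R / 8 by rewrite /a; field; rewrite gt_eqF.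
have Ka : (d%:R + 2) * L%:R * K%:R <= a.
  rewrite /a ler_pdivlMr ?mulr_gt0//; apply: le_trans K_small.
  by apply/le_of_eq; ring.
(* [phi] is strictly convex except at [M], where the source compensates for its
   kink; the gain [2 * a] elsewhere pays for the dead vertices. *)
pose phi i : R := (d%:R + 2) * a * (t i)%:R ^+ 2.
have [k kP] : exists k, forall i, phi i <= \sum_v psi k v i.
  apply: (strict_subsolution_le (y := fun k i => \sum_v psi k v i)
     (C := (d%:R + 2) * a * L%:R ^+ 2) (delta := a)) => //.
  - by move=> k i; rewrite sumr_ge0// => v _; apply: green_ge0.
  - move=> i; rewrite ler_wpM2l ?mulr_ge0 ?(ltW d2_gt0) ?(ltW a0)//.
    by rewrite ler_pXn2r ?nnegrE// ler_nat leq_subr.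
  move=> k c i c0 IH phi0; right.
  have t0 : (0 < t i)%N.
    by move: phi0; rewrite /phi; case: (t i) => //; rewrite expr0n mulr0 ltxx.
  have [iM Mi] := tent_range t0.
  apply: le_trans (sum_green_layer_step k iM Mi).
  have key : (d%:R * phi i + phi i.+1 + phi i.-1) / (d%:R + 2) - c <=
    (d%:R * (\sum_v psi k v i) + \sum_v psi k v i.+1 +
    \sum_v psi k v i.-1) / (d%:R + 2).
    rewrite lerBlDr ler_pdivrMr// mulrDl divfK ?gt_eqF//.
    have := ler_wpM2l (ler0n R d) (IH i); have := IH i.+1; have := IH i.-1.
    lra.
  apply: (@le_trans _ _ ((i == M)%:R * #|V|%:R + ((d%:R * phi i + phi i.+1 +
     phi i.-1) / (d%:R + 2) - c) - a)); last first.
    by rewrite lerB// lerD2l.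
  suff : phi i + a + a <= (i == M)%:R * #|V|%:R +
    (d%:R * phi i + phi i.+1 + phi i.-1) / (d%:R + 2) by lra.
  have -> : (d%:R * phi i + phi i.+1 + phi i.-1) / (d%:R + 2) = a * (d%:R *
     (t i)%:R ^+ 2 + (t i.+1)%:R ^+ 2 + (t i.-1)%:R ^+ 2).
    by rewrite /phi; field; rewrite gt_eqF.
  have [iEM|iNM] := eqVneq i M.
    rewrite /phi iEM tM tMS tMP.
    have -> : L.-1%:R = L%:R - 1 :> R by rewrite -subn1 natrB.
    have : #|V|%:R = 8 * (a * L%:R) by rewrite aL; lra.
    move=> ->; rewrite mul1r -subr_ge0.
    rewrite [X in 0 <= X](_ : _ = 4 * (a * L%:R)); last by ring.
    by rewrite !mulr_ge0// ltW.
  have [[tp tm]|[tp tm]] := tent_slope L_leM t0 iNM;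
    rewrite /phi /t {}tp {}tm mul0r add0r; move: t0; rewrite /t;
    case: (tent M L i) => // n _; rewrite /= -!natr1; apply: le_of_eq; ring.
exists k; have := kP M; rewrite /phi.
rewrite tM.
suff -> : (d%:R + 2) * a * L%:R ^+ 2 = (d%:R + 2) * #|V|%:R * L%:R / 8 by [].
transitivity ((d%:R + 2) * (a * L%:R) * L%:R); first by ring.
by rewrite aL; ring.
Qed.

End green_layer.

Lemma card_fset_set_seq (T : choiceType) (p : pred T) (s : seq T) :
  uniq s -> (forall z, p z = (z \in s)) ->
  #|` fset_set [set z | p z]%classic| = size s.
Proof.
move=> us ps; have -> : [set z | p z]%classic = [set` [fset x in s]%fset]%classic.
  by apply/seteqP; split => z /=; rewrite inE ps.
by rewrite set_fsetK card_fseq undup_id.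
Qed.

(** * The lazy random walk on the graph *)

Section lazy_walk.
Variables (R : realType) (V : finType) (e : rel V) (d : nat).
Hypothesis e_irr : irreflexive e.
Hypothesis e_reg : regular_graph e d.

Lemma lazy_stepE v u :
  lazy_step R e v u = if (v == u) || e v u then (d.+1%:R)^-1 else 0.
Proof.
rewrite /lazy_step /uniform_step; case: ifP => // _.
rewrite (@card_fset_set_seq _ _ (v :: enum [pred u | e v u])).
- by rewrite /= -cardE (card_nbrs e_reg).
- by rewrite /= enum_uniq mem_enum inE e_irr.
- by move=> z; rewrite in_cons mem_enum inE eq_sym.
Qed.

Lemma lazy_step_ge0 v u : 0 <= lazy_step R e v u.
Proof. by rewrite lazy_stepE; case: ifP. Qed.

Lemma lazy_prob_ge0 s v u : 0 <= lazy_prob R e s v u.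
Proof.
elim: s v u => [|s IH] v u /=; first by case: (v == u).
by apply: sumr_ge0 => z _; rewrite mulr_ge0// lazy_step_ge0.
Qed.

Lemma lazy_probSr s v u :
  lazy_prob R e s.+1 v u = \sum_z lazy_prob R e s v z * lazy_step R e z u.
Proof.
elim: s v u => [|s IH] v u.
  rewrite /= (bigD1 u)//= eqxx mulr1 big1 ?addr0; last first.
    by move=> z /negbTE ->; rewrite mulr0.
  rewrite (bigD1 v)//= eqxx mul1r big1 ?addr0// => z.
  by rewrite eq_sym => /negbTE ->; rewrite mul0r.
rewrite [LHS]/=; under eq_bigr do rewrite -/(lazy_prob R e s.+1 _ _) IH mulr_sumr.
rewrite exchange_big/=; apply: eq_bigr => z _; rewrite mulr_suml.
by apply: eq_bigr => w _; rewrite mulrA.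
Qed.

Definition lazy_avg (s : nat) (f : V -> R) (v : V) : R :=
  \sum_u lazy_prob R e s v u * f u.

Lemma lazy_avg0 f v : lazy_avg 0 f v = f v.
Proof.
rewrite /lazy_avg (bigD1 v)//= eqxx mul1r big1 ?addr0// => u.
by rewrite eq_sym => /negbTE ->; rewrite mul0r.
Qed.

Lemma le_lazy_avg s f g v : (forall u, f u <= g u) ->
  lazy_avg s f v <= lazy_avg s g v.
Proof. by move=> fg; apply: ler_sum => u _; rewrite ler_wpM2l// lazy_prob_ge0. Qed.

Lemma lazy_avg_ge0 s f v : (forall u, 0 <= f u) -> 0 <= lazy_avg s f v.
Proof. by move=> f0; apply: sumr_ge0 => u _; rewrite mulr_ge0// lazy_prob_ge0. Qed.

Lemma lazy_avgD s f g v :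
  lazy_avg s (fun u => f u + g u) v = lazy_avg s f v + lazy_avg s g v.
Proof. by rewrite /lazy_avg -big_split/=; apply: eq_bigr => u _; rewrite mulrDr. Qed.

Lemma lazy_avgZ s c f v : lazy_avg s (fun u => c * f u) v = c * lazy_avg s f v.
Proof. by rewrite /lazy_avg mulr_sumr; apply: eq_bigr => u _; rewrite mulrCA. Qed.

(** The extra term [f w] completes the neighbours to the [d.+1] equally likely moves of a lazy
    step. *)
Lemma lazy_avg_nbrs s f v :
  lazy_avg s (fun w => f w + \sum_(u | e w u) f u) v = d.+1%:R * lazy_avg s.+1 f v.
Proof.
rewrite /lazy_avg mulr_sumr.
under [RHS]eq_bigr do rewrite lazy_probSr mulr_suml mulr_sumr.
rewrite exchange_big/=; apply: eq_bigr => w _.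
under [RHS]eq_bigr do rewrite -mulrA mulrCA.
rewrite -mulr_sumr; congr (_ * _).
rewrite [RHS](bigID (fun u => (w == u) || e w u))/= [X in _ = _ + X]big1 ?addr0; last first.
  by move=> u /negbTE h; rewrite lazy_stepE h mul0r mulr0.
rewrite [RHS](bigD1 w) ?eqxx//=; congr (_ + _).
  by rewrite lazy_stepE eqxx mulrA mulfV ?mul1r.
apply: eq_big => u.
  by rewrite [u == w]eq_sym; case: (eqVneq w u) => [->|h]; rewrite ?e_irr ?andbF ?andbT.
move=> eu; rewrite lazy_stepE eu orbT mulrA mulfV ?mul1r//.
Qed.

End lazy_walk.

(** * Climbing above layer M until the horizontal position is mixed *)

Section climb.
Variables (R : realType) (V : finType) (e : rel V) (d : nat).
Hypothesis e_irr : irreflexive e.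
Hypothesis e_reg : regular_graph e d.
Hypothesis d_ge2 : (2 <= d)%N.
Variables (alive : V -> nat -> bool) (M L m : nat) (H : R).
Hypothesis alive_above : forall v i, (M < i)%N -> (i < M + L)%N -> alive v i.
Hypothesis m_gt0 : (0 < m)%N.
Hypothesis mixed : forall u v s, (m <= s)%N -> (2 * #|V|%:R)^-1 <= lazy_prob R e s v u.
Hypothesis H_gt0 : 0 < H.
Hypothesis H_mix : 2 * (1 + 3 * m%:R) <= H ^+ 2.
Hypothesis H_le : 8 * H <= L%:R.

Local Notation psi := (green e d alive (@layer_source R V M)).

(* Since [psi k] increases with [k], a holding step may be added to the simple
   walk, whose horizontal moves are then those of the lazy walk. *)
Lemma green_lazy_step k v i : (M < i)%N -> (i < M + L)%N ->
  (psi k v i + \sum_(u | e v u) psi k u i) + (psi k v i.+1 + psi k v i.-1) <=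
  (d%:R + 3) * psi k.+1 v i.
Proof.
move=> Mi iM; have le : psi k v i <= psi k.+1 v i.
  by apply: (le_green e_reg) => // u j; rewrite /layer_source.
have : (d%:R + 2) * psi k.+1 v i =
    \sum_(u | e v u) psi k u i + (psi k v i.+1 + psi k v i.-1).
  rewrite [X in _ * X]/= alive_above// /layer_source gtn_eqF//= add0r mulrC /walk_avg.
  by rewrite divfK ?addrA// gt_eqF//; have := ler0n R d; lra.
lra.
Qed.

(* Subsolution for the probability to make [s] lazy horizontal steps before
   returning to height 0, from height [i]. *)
Definition cubic (s i : nat) : R := i%:R / H * (1 - (i%:R ^+ 2 + 3 * s%:R) / H ^+ 2).

(** Lowering [s] by one gains [3 * (d + 1) * i / H ^+ 3], and concavity in [i] costs
    [6 * i / H ^+ 3]; for [d >= 2] and [i >= 1] the rest covers the strict gain [3 / H ^+ 3]. *)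
Lemma cubic_step s i : (0 < i)%N ->
  3 / H ^+ 3 + (d%:R + 3) * cubic s.+1 i <=
  (d%:R + 1) * cubic s i + (cubic s.+1 i.+1 + cubic s.+1 i.-1).
Proof.
case: i => // i _; have dR : 2 <= d%:R :> R by rewrite ler_nat.
have i0 := ler0n R i.
rewrite -subr_ge0 [X in 0 <= X](_ : _ = ((d%:R - 2) * 3 * (i%:R + 1) + 3 * i%:R) / H ^+ 3).
  by rewrite divr_ge0 ?exprn_ge0 ?(ltW H_gt0)//; nra.
by rewrite /cubic /= -!natr1; field; rewrite gt_eqF.
Qed.

Lemma cubic_le_half s i : cubic s i <= 2^-1.
Proof.
have i0 := ler0n R i; have s0 := ler0n R s; have Hi : 0 < H^-1 by rewrite invr_gt0.
apply: (@le_trans _ _ (i%:R / H * (1 - (i%:R / H) ^+ 2))).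
  rewrite ler_wpM2l ?divr_ge0 ?(ltW H_gt0)// lerD2l lerN2 expr_div_n.
  by rewrite ler_wpM2r ?invr_ge0 ?exprn_ge0 ?(ltW H_gt0)//; lra.
have : 0 <= i%:R / H by rewrite divr_ge0// ltW.
move: (i%:R / H) => t t0.
have [t1|t1] := lerP 1 t.
  have h : 1 - t ^+ 2 <= 0 by rewrite subr_le0 expr2; nra.
  have := mulr_ge0_le0 t0 h; lra.
have := sqr_ge0 (t - 2^-1); rewrite !expr2; nra.
Qed.

Lemma cubic_gt0 s i : 0 < cubic s i -> i%:R < H.
Proof.
rewrite /cubic => c0; rewrite ltNge; apply/negP => Hi; move: c0; apply/negP.
rewrite -leNgt mulr_ge0_le0 ?divr_ge0 ?(ltW H_gt0)// subr_le0.
rewrite ler_pdivlMr ?exprn_gt0// mul1r.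
have : H ^+ 2 <= i%:R ^+ 2 by rewrite ler_pXn2r ?nnegrE ?(ltW H_gt0).
have := ler0n R m; have := ler0n R s; lra.
Qed.

(** Together with [cubic_le_half] this glues the two subsolutions at the mixing time: the factor 8
    in [H_le] keeps the parabola above one half wherever [cubic] is positive. *)
Lemma parabola_ge_half i : i%:R < H -> 2^-1 <= parabola R L i.
Proof.
move=> iH; have i0 := ler0n R i.
have L0 : 0 < L%:R :> R by apply: lt_le_trans H_le; rewrite mulr_gt0.
have L1 : 1 <= L%:R :> R by rewrite ler1n -(ltr0n R).
have := H_gt0; have := H_le => HL H0.
rewrite /parabola ifT; last by rewrite -(ler_nat R); lra.
suff h : i%:R * (2 * L%:R + 1 - i%:R) / L%:R ^+ 2 <= 2^-1 :> R.
  by apply: (@le_trans _ _ (1 - 2^-1)); [lra | rewrite lerD2l lerN2].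
rewrite ler_pdivrMr ?exprn_gt0// expr2.
have : i%:R * (2 * L%:R + 1 - i%:R) <= (L%:R / 8) * (3 * L%:R) :> R.
  apply: ler_pM => //; try lra.
nra.
Qed.

(* [phi] is compared with the lazy averages [g] of the visits for all numbers
   [s] of lazy steps at once: [cubic] is used until [s] reaches the mixing
   time, and a recurrence estimate afterwards. *)
Lemma green_climb k0 c v : 0 <= c ->
  2 * #|V|%:R * c <= \sum_u psi k0 u M ->
  exists k, c / (2 * H) <= psi k v M.+1.
Proof.
move=> c_ge0; rewrite le_eqVlt in c_ge0; case/orP: c_ge0 => [/eqP <-|c0] sumc.
  by exists 0%N; rewrite mul0r.
have L0 : 0 < L%:R :> R by apply: lt_le_trans H_le; rewrite mulr_gt0.
have Lnat : (0 < L)%N by rewrite -(ltr0n R).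
have d3 : 0 < d%:R + 3 :> R by have := ler0n R d; lra.
have psi0 k u i : 0 <= psi k u i by apply: (green_ge0 e_reg) => w j; rewrite /layer_source.
pose g k (x : nat * V * nat) :=
  lazy_avg e x.1.1 (fun w => psi (k0 + k)%N w (M + x.2)%N) x.1.2.
(* A state consists of the number of lazy steps made, their starting vertex and the height above
   layer [M]; [cubic] takes the number of steps still missing. *)
pose phi (x : nat * V * nat) :=
  c * (if (x.1.1 < m)%N then cubic (m - x.1.1) x.2 else parabola R L x.2).
have g_step k s u i : (0 < i < L)%N ->
   (d%:R + 1) * g k (s.+1, u, i) + (g k (s, u, i.+1) + g k (s, u, i.-1)) <=
   (d%:R + 3) * g k.+1 (s, u, i).
  move=> /andP[i0 iL]; rewrite /g /= natr1 -(lazy_avg_nbrs e_irr e_reg).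
  rewrite -!lazy_avgD -lazy_avgZ; apply: (le_lazy_avg e_irr e_reg) => w.
  rewrite !addnS; case: i i0 iL => // i _ iL; rewrite addnS.
  apply: green_lazy_step; lia.
pose del := Num.min (3 / H ^+ 3) (2 / L%:R ^+ 2).
have del0 : 0 < del by rewrite lt_min !divr_gt0 ?exprn_gt0.
have [k kP] : exists k, forall x, phi x <= g k x.
  apply: (strict_subsolution_le (C := c) (delta := c * del / (d%:R + 3))).
  - by rewrite divr_gt0// mulr_gt0.
  - by move=> k x; apply: (lazy_avg_ge0 e_irr e_reg) => u; exact: psi0.
  - move=> [[s u] i]; rewrite /phi /= -[leRHS]mulr1 ler_wpM2l ?(ltW c0)//.
    case: ifP => _; last exact: parabola_le1.
    by apply: le_trans (cubic_le_half _ _) _; lra.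
  move=> k b [[s u] [|i]] b0 IH phi0.
    left; move: phi0; rewrite /phi /=; case: ifP => [_|].
      by rewrite /cubic mul0r mul0r mulr0 ltxx.
    (* Back on layer [M] after at least [m] lazy steps, every vertex has weight at least
       [1 / (2 * #|V|)], and the assumption on [psi k0] yields [c]. *)
    move=> /negbT; rewrite -leqNgt => ms _.
    rewrite /parabola /= mul0r mul0r subr0 mulr1 /g addn0 /=.
    apply: (@le_trans _ _ (lazy_avg e s (fun w => psi k0 w M) u)); last first.
      apply: (le_lazy_avg e_irr e_reg) => w; apply: (le_green e_reg); last by lia.
      by move=> *; rewrite /layer_source.
    apply: (@le_trans _ _ (\sum_w (2 * #|V|%:R)^-1 * psi k0 w M)); last first.
      by apply: ler_sum => w _; rewrite ler_wpM2r// mixed.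
    have V0 : 0 < #|V|%:R :> R by rewrite ltr0n; apply/card_gt0P; exists u.
    by rewrite -mulr_sumr ler_pdivlMl// mulr_gt0.
  right; have iL : (0 < i.+1 < L)%N.
    move: phi0; rewrite /phi pmulr_rgt0//=; case: ifP => _.
      move=> /cubic_gt0 iH; rewrite -(ltr_nat R); apply: lt_le_trans iH _.
      by have := H_gt0; have := H_le; lra.
    exact: parabola_gt0_lt.
  have IHs := IH (s.+1, u, i.+1); have IHp := IH (s, u, i.+2); have IHm := IH (s, u, i).
  have := g_step k s u i.+1 iL => /= gs.
  rewrite -(ler_pM2l d3); apply: le_trans gs.
  rewrite mulrDr [_ * (c * del / _)]mulrC divfK ?gt_eqF//.
  have d1 : 0 <= d%:R + 1 :> R by rewrite natr1.
  have := ler_wpM2l d1 IHs.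
  suff : (d%:R + 3) * phi (s, u, i.+1) + c * del <=
     (d%:R + 1) * phi (s.+1, u, i.+1) + (phi (s, u, i.+2) + phi (s, u, i)) by lra.
  have scale (p q x y : R) : (d%:R + 3) * p + del <= (d%:R + 1) * q + (x + y) ->
      (d%:R + 3) * (c * p) + c * del <= (d%:R + 1) * (c * q) + (c * x + c * y).
    move=> /(ler_wpM2l (ltW c0)).
    by rewrite !mulrDr ![c * (_ * _)]mulrCA !mulrDl.
  have delH : del <= 3 / H ^+ 3 by rewrite ge_min lexx.
  have delL : del <= 2 / L%:R ^+ 2 by rewrite ge_min lexx orbT.
  rewrite /phi /=; case: (ltnP s m) phi0 => [sm|ms] phi0.
    have cstep := @cubic_step (m - s.+1) i.+1 isT.
    rewrite subnSK// /= in cstep.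
    have [sm1|sm1] := ltnP s.+1 m; apply: scale.
      by move: cstep delH; lra.
    (* When [s.+1 = m] the next lazy step switches to [parabola], which is at least [cubic 0] since
       they lie on either side of one half. *)
    have sm0 : (m - s.+1 = 0)%N by apply/eqP.
    rewrite sm0 in cstep.
    have iH : i.+1%:R < H by move: phi0; rewrite /phi /= sm pmulr_rgt0// => /cubic_gt0.
    have := le_trans (cubic_le_half 0 i.+1) (parabola_ge_half iH).
    by move=> /(ler_wpM2l d1); move: cstep delH; lra.
  rewrite ltnNge (leq_trans ms)//=; apply: scale.
  have := @parabola_step R L i.+1 isT (proj2 (andP iL)) => /=.
  by move: delL; lra.
(* At [v] and height 1, before any lazy step, [phi] is [c] times [cubic m 1 = (1 - (1 + 3 * m) / H
   ^+ 2) / H], and [H_mix] makes the bracket at least one half. *)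
exists (k0 + k)%N; have := kP (0%N, v, 1%N); rewrite /phi /g /= lazy_avg0 addn1.
apply: le_trans; rewrite m_gt0 subn0 ler_pM2l// /cubic invfM mulrC mul1r.
have H0 := H_gt0; rewrite ler_pM2l ?invr_gt0// expr1n.
suff h : (1 + 3 * m%:R) / H ^+ 2 <= 2^-1 :> R.
  by apply: (@le_trans _ _ (1 - 2^-1)); [lra | rewrite lerD2l lerN2].
by rewrite ler_pdivrMr ?exprn_gt0//; have := H_mix; lra.
Qed.

End climb.

(** * Sticking to a prescribed tip in layer M *)

Section tip.
Variables (R : realType) (V : finType) (e : rel V) (d : nat).
Hypothesis e_sym : symmetric e.
Hypothesis e_irr : irreflexive e.
Hypothesis e_reg : regular_graph e d.
Hypothesis d_ge2 : (2 <= d)%N.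
Variables (stop : V -> nat -> bool) (v0 : V) (M L K m : nat) (H : R).
Hypothesis L_leM : (L <= M)%N.
Hypothesis stop_tip : stop v0 M.
Hypothesis stop_above : forall v i, (M < i)%N -> ~~ stop v i.
Hypothesis card_stop : forall i, (M < i + L)%N ->
  (#|[pred v | stop v i]| <= K)%N.
Hypothesis K_small : 8 * (d%:R + 2) * L%:R ^+ 2 * K%:R <= #|V|%:R :> R.
Hypothesis m_gt0 : (0 < m)%N.
Hypothesis mixed : forall u v s, (m <= s)%N -> (2 * #|V|%:R)^-1 <= lazy_prob R e s v u.
Hypothesis H_gt0 : 0 < H.
Hypothesis H_mix : 2 * (1 + 3 * m%:R) <= H ^+ 2.
Hypothesis H_le : 8 * H <= L%:R.

Let tip (v : V) (i : nat) := (v == v0) && (i == M).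
Let alive v i := ~~ stop v i && ((M < i + L)%N && (i < M + L)%N).
Let tip_avg := walk_avg e d (fun v i => (tip v i)%:R : R).

(** Decomposes a hit of the tip at its last step: [tip_avg] is the chance to step onto the tip, and
    killing outside the window only loses paths. The tip is stopped, hence dead, so the Green
    function vanishes there and nothing is counted twice. *)
Let green_le_hit_prob k v i : green e d alive tip_avg k v i <= hit_prob R e d stop tip k v i.
Proof.
elim: k v i => [|k IH] v i; first exact: hit_prob_ge0.
rewrite /=; case: ifP => [/andP[/negbTE -> /andP[iM _]]|_]; last exact: (@hit_prob_ge0 R V e d e_reg stop tip k.+1 v i).
rewrite ifF; last by apply/negbTE; rewrite -lt0n; move: iM L_leM; clear; lia.
rewrite /tip_avg -walk_avgD.
have le u j : (tip u j)%:R + green e d alive tip_avg k u j <= hit_prob R e d stop tip k u j.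
  case: (boolP (tip u j)) => [/andP[/eqP -> /eqP ->]|_]; last by rewrite add0r.
  by rewrite green_dead ?addr0 ?hit_prob_stop// ?/tip ?/alive ?stop_tip ?eqxx.
by apply: le_walk_avg => *; exact: le.
Qed.

(* The walk kernel is symmetric, so the chance of ending at the tip is
   governed by the expected number of visits to layer M of the walk started
   next to the tip. *)
Lemma hit_prob_tip : exists k, L%:R / (32 * H) <= \sum_u hit_prob R e d stop tip k u M.
Proof.
have d2 : 0 < d%:R + 2 :> R by have := ler0n R d; lra.
have H1 : 1 < H.
  rewrite ltNge; apply/negP => h1; have := H_mix; have := H_gt0.
  have : H ^+ 2 <= 1 by rewrite expr_le1// ltW.
  by have := ler0n R m; lra.
have L2 : (1 < L)%N by rewrite -(ltr_nat R); have := H_le; lra.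
have L0 : (0 < L)%N by rewrite ltnW.
have V0 : (0 < #|V|)%N by apply/card_gt0P; exists v0.
have alive_range v i : alive v i -> (M < i + L)%N && (i < M + L)%N by case/andP.
have alive_above v i : (M < i)%N -> (i < M + L)%N -> alive v i.
  by move=> Mi iM; rewrite /alive stop_above// iM ltn_addr.
have dead i : (M < i + L)%N -> (i < M + L)%N -> (#|[pred v | ~~ alive v i]| <= K)%N.
  move=> iL Mi; rewrite (leq_trans _ (card_stop iL))// eq_leq//.
  by apply: eq_card => v; rewrite !inE /alive iL Mi !andbT negbK.
have [k0 k0P] := sum_green_layer e_sym e_reg L0 L_leM alive_range dead K_small V0.
have c0 : 0 <= (d%:R + 2) * L%:R / 16 :> R by rewrite divr_ge0// mulr_ge0// ltW.
have c_le : 2 * #|V|%:R * ((d%:R + 2) * L%:R / 16) <=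
    \sum_u green e d alive (@layer_source R V M) k0 u M.
  by apply: le_trans k0P; rewrite le_eqVlt; apply/orP; left; apply/eqP; field.
have [k kP] := green_climb e_irr e_reg d_ge2 alive_above m_gt0 mixed H_gt0 H_mix
  H_le v0 c0 c_le.
exists k; apply: (@le_trans _ _ (\sum_u green e d alive tip_avg k u M)); last first.
  by apply: ler_sum => u _; exact: green_le_hit_prob.
have aN v i : alive v i -> (0 < i < M + L)%N.
  by move=> /alive_range /andP[iM ->]; rewrite andbT; move: iM L_leM; clear; lia.
have adj := green_adjoint e_sym e_reg (@layer_source R V M) tip_avg k aN.
set lhs := (X in X = _) in adj.
have -> : \sum_u green e d alive tip_avg k u M = lhs.
  have MN : (M < M + L)%N by rewrite -{1}[M]addn0 ltn_add2l.
  rewrite adj [RHS](bigD1 (Ordinal MN))//= [X in _ + X]big1 ?addr0; last first.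
    move=> i iM; apply: big1 => v _; rewrite /layer_source.
    by have /negbTE -> : val i != M by []; rewrite mul0r.
  rewrite (bigID (fun v => alive v M))/= [X in _ + X]big1 ?addr0; last first.
    by move=> v av; rewrite green_dead.
  by apply: eq_bigr => v _; rewrite /layer_source eqxx mul1r.
have MS : (M.+1 < M + L)%N by rewrite -addn1 ltn_add2l.
have t0 v i : 0 <= (tip v i)%:R :> R by [].
have b0 v i : 0 <= tip_avg v i by apply: (walk_avg_ge0 e_reg).
have g0 v i : 0 <= green e d alive (@layer_source R V M) k v i.
  by apply: (green_ge0 e_reg) => *; rewrite /layer_source.
(* Of the whole sum only the site just above the tip is kept; it is alive and steps onto the tip
   with probability [1 / (d + 2)]. *)
apply: (@le_trans _ _ (green e d alive (@layer_source R V M) k v0 M.+1 * tip_avg v0 M.+1)).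
  have b1 : (d%:R + 2)^-1 <= tip_avg v0 M.+1.
    rewrite /tip_avg /walk_avg /tip !eqxx /= -[leLHS]mul1r ler_pM2r ?invr_gt0//.
    by rewrite lerDr addr_ge0// sumr_ge0.
  apply: le_trans (ler_pM _ _ kP b1); rewrite ?invr_ge0 ?(ltW d2) ?divr_ge0//; last first.
    by rewrite mulr_ge0 ?(ltW H_gt0).
  rewrite le_eqVlt; apply/orP; left; apply/eqP; field.
  by rewrite !gt_eqF.
rewrite /lhs (bigD1 (Ordinal MS))//= (bigD1 v0)/=; last exact: alive_above.
rewrite -addrA lerDl addr_ge0//; apply: sumr_ge0 => *; first by rewrite mulr_ge0.
by apply: sumr_ge0 => *; rewrite mulr_ge0.
Qed.

End tip.

Lemma cyl_adj_sym (V : finType) (e : rel V) : symmetric e -> symmetric (cyl_adj e).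
Proof.
move=> es x y; rewrite /cyl_adj es [x.2 == _]eq_sym [x.1 == _]eq_sym.
by rewrite [X in _ || (X && _)]orbC.
Qed.

(** * Neighbours and transition probabilities on the cylinder *)

Section cylinder_steps.
Variables (R : realType) (V : finType) (e : rel V) (d : nat).
Hypothesis e_reg : regular_graph e d.

Definition cyl_nbrs (v : V) (i : nat) : seq (V * nat) :=
  [:: (v, i.+1), (v, i.-1) & [seq (u, i) | u <- enum [pred u | e v u]]].

Lemma cyl_nbrs_uniq v i : (0 < i)%N -> uniq (cyl_nbrs v i).
Proof.
move=> i0; rewrite /= map_inj_uniq ?enum_uniq => [|u w []//].
rewrite andbT inE negb_or -andbA; apply/and3P; split.
- by apply/eqP => -[]; lia.
- by apply/mapP => -[u _ []]; lia.
- by apply/mapP => -[u _ []]; lia.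
Qed.

Lemma mem_cyl_nbrs v i z : (0 < i)%N ->
  cyl_adj e (v, i) z = (z \in cyl_nbrs v i).
Proof.
case: z => w j i0; rewrite /cyl_adj !inE !xpair_eqE /=.
have -> : ((w, j) \in [seq (u, i) | u <- enum [pred u | e v u]]) = (j == i) && e v w.
  apply/mapP/andP => [[u]|[/eqP -> vw]].
    by rewrite mem_enum inE => vu [-> ->].
  by exists w => //; rewrite mem_enum inE.
rewrite [i == j]eq_sym [v == w]eq_sym.
case: (w == v) => /=; rewrite ?andbT ?andbF ?orbF//.
have -> : (i == j.+1) = (j == i.-1) by lia.
by case: (j == i.+1); case: (j == i.-1); rewrite ?orbT ?orbF.
Qed.

Lemma uniform_step_cyl v i y : (0 < i)%N -> y \in cyl_nbrs v i ->
  uniform_step R (cyl_adj e) (v, i) y = (d%:R + 2)^-1.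
Proof.
move=> i0 yi; rewrite /uniform_step mem_cyl_nbrs// yi.
rewrite (@card_fset_set_seq _ _ (cyl_nbrs v i)) ?cyl_nbrs_uniq//.
  by rewrite /= size_map -cardE (card_nbrs e_reg) -natrD addn2.
by move=> z; rewrite mem_cyl_nbrs.
Qed.

Lemma walk_avg_nbrs (f : V -> nat -> R) v i :
  walk_avg e d f v i = \sum_(y <- cyl_nbrs v i) (d%:R + 2)^-1 * f y.1 y.2.
Proof.
rewrite -mulr_sumr mulrC /walk_avg; congr (_ * _).
by rewrite !big_cons big_map big_enum/= -[LHS]addrA addrC [RHS]addrA.
Qed.

End cylinder_steps.

(** * Countable partitions of the probability space *)

Section real_probability.
Variables (R : realType) (disp : measure_display) (Omega : measurableType disp).
Variable P : probability Omega R.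
Local Open Scope classical_set_scope.

Lemma measurable_fibers (T : countType) (f : Omega -> T) (Y : set T) :
  (forall y, measurable [set w | f w = y]) -> measurable [set w | Y (f w)].
Proof.
move=> mf.
have -> : [set w | Y (f w)] =
  \bigcup_(k in [set k | exists y, Y y /\ choice.pickle y = k])
    [set w | choice.pickle (f w) = k].
  by apply/seteqP; split => [w Yw|w [k [y [Yy <-]]] /= /(pcan_inj choice.pickleK) ->]//;
    exists (choice.pickle (f w)) => //; exists (f w).
apply: bigcup_measurable => k [y [_ <-]].
have -> : [set w | choice.pickle (f w) = choice.pickle y] = [set w | f w = y]; last exact: mf.
by apply/seteqP; split => w /= => [/(pcan_inj choice.pickleK)|->].
Qed.

Definition prob (F : set Omega) : R := fine (P F).

Lemma probE F : measurable F -> P F = (prob F)%:E.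
Proof. by move=> mF; rewrite fineK// fin_num_measure. Qed.

Lemma prob_ge0 F : 0 <= prob F.
Proof. by rewrite /prob fine_ge0. Qed.

Lemma le_prob F G : measurable F -> measurable G -> F `<=` G -> prob F <= prob G.
Proof.
move=> mF mG FG; rewrite -lee_fin -!probE//.
by apply: le_measure => //; rewrite inE.
Qed.

Lemma sum_prob_fibers_le (T : eqType) (f : Omega -> T) (F : set Omega) (s : seq T) :
  measurable F -> (forall y, measurable [set w | f w = y]) -> uniq s ->
  \sum_(y <- s) prob (F `&` [set w | f w = y]) <= prob F.
Proof.
move=> mF mf us.
have mFy y : measurable (F `&` [set w | f w = y]) by exact: measurableI.
have ms (r : seq T) : measurable (F `&` [set w | f w \in r]).
  apply: measurableI => //; elim: r => [|y r IH].
    by rewrite (_ : [set _ | _] = set0)//; apply/seteqP; split.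
  rewrite (_ : [set _ | _] = [set w | f w = y] `|` [set w | f w \in r]).
    exact: measurableU.
  apply/seteqP; split => w /=; rewrite inE.
    by move=> /orP[/eqP ->|wr]; [left|right].
  by move=> [->|->]; rewrite ?eqxx ?orbT.
suff -> : \sum_(y <- s) prob (F `&` [set w | f w = y]) = prob (F `&` [set w | f w \in s]).
  by apply: le_prob => // w [].
elim: s us => [|y s IH] /=.
  rewrite big_nil => _; rewrite (_ : _ `&` _ = set0) /prob ?measure0//.
  by apply/seteqP; split => w// [].
move=> /andP[ys us]; rewrite big_cons IH//.
apply/eqP; rewrite -eqe EFinD -!probE//.
rewrite -measureU//.
  apply/eqP; congr (P _); apply/seteqP; split => w /=; rewrite inE.
    by move=> [[Fw ->]|[Fw ->]]; rewrite ?eqxx ?orbT.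
  by move=> [Fw /orP[/eqP|]]; [left|right].
apply/seteqP; split => w// [[_ /= ->]] [_ /=]; by rewrite (negbTE ys).
Qed.

End real_probability.

(** * From hitting probabilities to one step of the process *)

Section one_step.
Variables (R : realType) (d : nat) (disp : measure_display) (Omega : measurableType disp).
Variables (P : probability Omega R) (V : finType) (e : rel V).
Variables (A : nat -> Omega -> {fset V * nat}) (X : nat -> nat -> Omega -> V * nat).
Hypothesis e_sym : symmetric e.
Hypothesis e_reg : regular_graph e d.
Hypothesis cdla : cylinder_DLA P e A X.
Local Open Scope classical_set_scope.

Definition history t (a : nat -> {fset V * nat}) : set Omega :=
  [set w | forall s, (s <= t)%N -> A s w = a s].

Definition trajectory t k (x : nat -> V * nat) : set Omega :=
  [set w | forall r, (r <= k)%N -> X t.+1 r w = x r].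

Definition hits t (b : {fset V * nat}) (target : V -> nat -> bool) : set Omega :=
  [set w | exists r, is_hitting_time e b (fun r' => X t.+1 r' w) r /\
                     target (X t.+1 r w).1 (X t.+1 r w).2].

(** The cluster is included along with its boundary: a walk released outside [b] meets the boundary
    before [b], so nothing changes for it, and every site above a particle counts as stopped. *)
Definition stopped (b : {fset V * nat}) (v : V) (i : nat) : bool :=
  ((v, i) \in b) || `[<boundary e b (v, i)>].

Lemma measurable_history t a : measurable (history t a).
Proof.
rewrite (_ : history t a = \bigcap_(s in [set s | (s <= t)%N]) [set w | A s w = a s])//.
by apply: bigcap_measurableType => s _; exact: (cdla_measurable_cluster cdla).
Qed.

Lemma measurable_walk t r (Y : set (V * nat)) : measurable [set w | Y (X t r w)].
Proof. by apply: measurable_fibers => y; exact: (cdla_measurable_walk cdla). Qed.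

Lemma measurable_trajectory t k x : measurable (trajectory t k x).
Proof.
rewrite (_ : trajectory t k x =
  \bigcap_(r in [set r | (r <= k)%N]) [set w | X t.+1 r w = x r])//.
by apply: bigcap_measurableType => s _; exact: (cdla_measurable_walk cdla).
Qed.

Lemma measurable_hits t b target : measurable (hits t b target).
Proof.
rewrite (_ : hits t b target = \bigcup_r ([set w | boundary e b (X t.+1 r w) /\
   target (X t.+1 r w).1 (X t.+1 r w).2] `&`
   \bigcap_(s in [set s | (s < r)%N]) [set w | ~ boundary e b (X t.+1 s w)])).
  apply: bigcup_measurable => r _; apply: measurableI.
    exact: (@measurable_walk t.+1 r [set y | boundary e b y /\ target y.1 y.2]).
  apply: bigcap_measurableType => s _.
  exact: (@measurable_walk t.+1 s [set y | ~ boundary e b y]).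
apply/seteqP; split => w /=.
  by move=> [r [[h1 h2] h3]]; exists r => //; split => // s /= sr; exact: h2.
by move=> [r _ [[h1 h3] h2]]; exists r; split => //; split => // s sr; exact: h2.
Qed.

Local Notation pr := (prob P).

Lemma prob_trajectory t a k x :
  pr (history t a `&` trajectory t k x) =
  pr (history t a) * walk_law R e (first_empty_layer (a t)) k x.
Proof.
apply/eqP; rewrite -eqe EFinM -!probE//; first exact/eqP/(cdla_walk cdla).
  exact: measurable_history.
by apply: measurableI; [exact: measurable_history|exact: measurable_trajectory].
Qed.

(** Induction on the remaining steps: splitting over the next position extends the observed
    trajectory by one vertex, and [prob_trajectory] gives each extension the factor
    [1 / (d + 2)]. *)
Lemma hit_prob_le_hits t a target k r x :
  (forall s, (s < r)%N -> ~~ stopped (a t) (x s).1 (x s).2) -> x r \notin a t ->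
  pr (history t a `&` trajectory t r x) *
    hit_prob R e d (stopped (a t)) target k (x r).1 (x r).2 <=
  pr (history t a `&` trajectory t r x `&` hits t (a t) target).
Proof.
have mH := measurable_history t a.
have mT r' x' := measurable_trajectory t r' x'.
have mHT r' x' : measurable (history t a `&` trajectory t r' x') by exact: measurableI.
have mHTE r' x' : measurable (history t a `&` trajectory t r' x' `&` hits t (a t) target).
  by apply: measurableI => //; exact: measurable_hits.
have hit_now k' r' x' :
    (forall s, (s < r')%N -> ~~ stopped (a t) (x' s).1 (x' s).2) ->
    x' r' \notin a t -> stopped (a t) (x' r').1 (x' r').2 ->
    pr (history t a `&` trajectory t r' x') *
      hit_prob R e d (stopped (a t)) target k' (x' r').1 (x' r').2 <=
    pr (history t a `&` trajectory t r' x' `&` hits t (a t) target).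
  move=> xs xr sr; rewrite hit_prob_stop//.
  case: (boolP (target _ _)) => [tr|_]; last by rewrite mulr0 prob_ge0.
  rewrite mulr1; apply: le_prob => // w [hw tw]; split => //; exists r'.
  rewrite tw//; split => //; split => [|s srr].
    by move: sr; rewrite /stopped -surjective_pairing (negbTE xr) => /asboolP; rewrite tw.
  move: (xs s srr); rewrite /stopped -surjective_pairing negb_or tw ?(ltnW srr)//.
  by move=> /andP[_ /asboolP].
elim: k r x => [|k IH] r x xs xr;
  have [sr|sr] := boolP (stopped (a t) (x r).1 (x r).2); try exact: hit_now.
  by rewrite /= (negbTE sr) mulr0 prob_ge0.
rewrite [hit_prob _ _ _ _ _ _ _ _]/= (negbTE sr).
case: eqP => [_|/eqP]; first by rewrite mulr0 prob_ge0.
rewrite -lt0n => xr0; rewrite walk_avg_nbrs mulr_sumr.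
have us := cyl_nbrs_uniq e (x r).1 xr0.
apply: le_trans (sum_prob_fibers_le P (mHTE r x) (cdla_measurable_walk cdla t.+1 r.+1) us).
rewrite big_seq [leRHS]big_seq; apply: ler_sum => y yn.
pose x' q := if (q <= r)%N then x q else y.
have xE q : (q <= r)%N -> x' q = x q by rewrite /x' => ->.
have xrE : x' r.+1 = y by rewrite /x' ltnn.
have HTE : history t a `&` trajectory t r x `&` [set w | X t.+1 r.+1 w = y] =
    history t a `&` trajectory t r.+1 x'.
  apply/seteqP; split => w /=.
    move=> [[hw tw] wy]; split => // q; rewrite leq_eqVlt => /orP[/eqP ->|qr].
      by rewrite xrE.
    by rewrite xE// tw.
  move=> [hw tw]; split; last by rewrite tw// xrE.
  by split => // q qr; rewrite tw ?xE// leqW.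
have prE : pr (history t a `&` trajectory t r.+1 x') =
   pr (history t a `&` trajectory t r x) * (d%:R + 2)^-1.
  rewrite !prob_trajectory -mulrA; congr (_ * _).
  rewrite /walk_law big_ord_recr/= mulrA; congr (_ * _); last first.
    by rewrite xE// xrE [x r]surjective_pairing (uniform_step_cyl R e_reg).
  rewrite xE//; congr (_ * _); apply: eq_bigr => q _.
  by rewrite !xE// ltnW.
rewrite mulrA -prE setIAC HTE.
have := IH r.+1 x'; rewrite xrE; apply.
- move=> s; rewrite ltnS => srr; rewrite xE//.
  by move: srr; rewrite leq_eqVlt => /orP[/eqP ->//|]; exact: xs.
(* An unstopped site is neither in the cluster nor on its boundary, so its neighbours lie outside
   the cluster too. *)
- apply/negP => ya; move/negP: sr; apply.
  rewrite /stopped -surjective_pairing; apply/orP; right; apply/asboolP.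
  split => //; exists y => //.
  by rewrite cyl_adj_sym// [x r]surjective_pairing mem_cyl_nbrs.
Qed.

(** [p] is at most the supremum, over finite horizons [k], of the chance that a walk released
    uniformly on the first empty layer stops at a target; [eps] avoids passing to the limit. *)
Definition reach (b : {fset V * nat}) (target : V -> nat -> bool) (p : R) :=
  forall eps : R, 0 < eps -> exists k, p - eps <=
    (\sum_u hit_prob R e d (stopped b) target k u (first_empty_layer b)) / #|V|%:R.

Lemma first_empty_layerP (b : {fset V * nat}) u : (u, first_empty_layer b) \notin b.
Proof.
rewrite /first_empty_layer; case: ex_minnP => i /eqP bi _.
apply/negP => ub; suff : (u, i) \in fset0 by rewrite inE.
by rewrite -bi inE ub andbT; apply/imfsetP; exists u.
Qed.

Lemma reach_hits t a target p : reach (a t) target p ->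
  pr (history t a) * p <= pr (history t a `&` hits t (a t) target).
Proof.
move=> reach_p; apply/ler_addgt0Pl => eps eps0.
have mH := measurable_history t a.
have mHE : measurable (history t a `&` hits t (a t) target).
  by apply: measurableI => //; exact: measurable_hits.
have [k kP] := reach_p _ eps0; set M := first_empty_layer (a t) in kP.
have p1 : pr (history t a) <= 1.
  by rewrite -lee_fin -probE// probability_le1.
suff : pr (history t a) * ((\sum_u hit_prob R e d (stopped (a t)) target k u M) / #|V|%:R)
    <= pr (history t a `&` hits t (a t) target).
  have := ler_wpM2l (prob_ge0 P (history t a)) kP.
  rewrite mulrBr; have : pr (history t a) * eps <= eps.
    by rewrite ler_piMl// ltW.
  lra.
have us : uniq [seq (u, M) | u <- enum V].
  by rewrite map_inj_uniq ?enum_uniq// => u w [].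
apply: le_trans (sum_prob_fibers_le P mHE (cdla_measurable_walk cdla t.+1 0%N) us).
rewrite mulr_suml mulr_sumr big_map big_enum/=; apply: ler_sum => u _.
have HTE : history t a `&` hits t (a t) target `&` [set w | X t.+1 0%N w = (u, M)] =
    history t a `&` trajectory t 0 (fun=> (u, M)) `&` hits t (a t) target.
  apply/seteqP; split => w /=.
    by move=> [[hw tw] wu]; split => //; split => // q; rewrite leqn0 => /eqP ->.
  by move=> [[hw tw] tt]; split; [split | rewrite tw].
rewrite HTE.
have := @hit_prob_le_hits t a target k 0 (fun=> (u, M)).
rewrite prob_trajectory /walk_law eqxx big_ord0 mulr1 /= -mulrA => h.
rewrite [_ / _]mulrC; apply: h => //; exact: first_empty_layerP.
Qed.

End one_step.

(** * Occupied layers and particle counts of a cluster *)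

Section clusters.
Variables (V : finType) (e : rel V).
Local Notation cluster := {fset V * nat}.
Implicit Types b : cluster.
Local Notation top := first_empty_layer.

Definition count_above b (j : nat) : nat := #|` [fset x in b | (j <= x.2)%N]%fset|.

Lemma card_row b i :
  #|[pred v | (v, i) \in b]| = #|` [fset x in b | x.2 == i]%fset|.
Proof.
rewrite (_ : [fset x in b | x.2 == i]%fset =
  [fset (v, i) | v in [fset v in [pred v | (v, i) \in b]]%fset]%fset).
  rewrite card_imfset/=; last by move=> u v [].
  by rewrite card_imfset //= cardE.
apply/fsetP => -[v j]; rewrite !inE /=; apply/andP/imfsetP => /=.
  by move=> [vj /eqP ji]; exists v; rewrite ?inE -?ji.
by move=> [u]; rewrite !inE => ub [-> ->].
Qed.

Lemma card_row_le b i j : (j <= i)%N ->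
  (#|[pred v | (v, i) \in b]| <= count_above b j)%N.
Proof.
move=> ji; rewrite card_row fsubset_leq_card//; apply/fsubsetP => x.
by rewrite !inE => /andP[-> /eqP ->].
Qed.

Lemma count_above_row b j :
  (count_above b j <= #|[pred v | (v, j) \in b]| + count_above b j.+1)%N.
Proof.
rewrite card_row.
apply: leq_trans (leq_card_fsetU _ _); apply: fsubset_leq_card.
apply/fsubsetP => x; rewrite !inE => /andP[-> /=].
by rewrite leq_eqVlt [_ == j]eq_sym.
Qed.

Lemma le_count_above b b' j : (b `<=` b')%fset -> (count_above b j <= count_above b' j)%N.
Proof.
move=> /fsubsetP bb'; apply/fsubset_leq_card/fsubsetP => x.
by rewrite !inE => /andP[/bb' -> ->].
Qed.

Lemma count_aboveU1 b y j : y \notin b -> (j <= y.2)%N ->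
  count_above (y |` b)%fset j = (count_above b j).+1.
Proof.
move=> yb jy; rewrite /count_above.
rewrite (_ : [fset x in y |` b | _]%fset = (y |` [fset x in b | (j <= x.2)%N])%fset).
  by rewrite cardfsU1 !inE (negbTE yb).
by apply/fsetP => x; rewrite !inE andb_orl; case: eqP => //= ->; rewrite jy.
Qed.

Lemma layer_occupied b i : (i < top b)%N -> exists u, (u, i) \in b.
Proof.
rewrite /first_empty_layer; case: ex_minnP => m _ minm im.
have /eqP/fset0Pn[[u j]] : (layer V i `&` b)%fset <> fset0.
  by move=> /eqP /minm; rewrite leqNgt im.
by rewrite !inE => /andP[/imfsetP[v _ [-> ->]] vb]; exists v.
Qed.

Lemma lt_first_empty_layer b j :
  (forall i, (i <= j)%N -> exists u, (u, i) \in b) -> (j < top b)%N.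
Proof.
move=> h; rewrite ltnNge; apply/negP => /h[u].
by apply/negP/first_empty_layerP.
Qed.

Lemma le_first_empty_layer b b' : (b `<=` b')%fset -> (top b <= top b')%N.
Proof.
move=> /fsubsetP bb'; case E : (top b) => [//|m].
apply: lt_first_empty_layer => i im.
by have [|u /bb'] := @layer_occupied b i; [rewrite E | exists u].
Qed.

Lemma lt_first_empty_layer_add b b' u : (b `<=` b')%fset -> (u, top b) \in b' ->
  (top b < top b')%N.
Proof.
move=> /fsubsetP bb' ub; apply: lt_first_empty_layer => i.
rewrite leq_eqVlt => /orP[/eqP ->|/layer_occupied[v /bb']]; first by exists u.
by exists v.
Qed.

(** The invariant of the process. Since all layers below [top b] are occupied, the occupied layers
    are exactly these, and the bottom one is full. *)
Definition stacked b : Prop :=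
  (forall u, (u, 0%N) \in b) /\ (forall x, x \in b -> (x.2 < top b)%N).

Lemma stacked_boundary b y : stacked b -> boundary e b y -> (y.2 <= top b)%N.
Proof.
case: y => v j [_ sb] [_ [[u i] /sb /= xt]]; rewrite /cyl_adj /=.
by move: xt; move: (top b) => t; lia.
Qed.

Lemma stacked_add b y : stacked b -> boundary e b y -> stacked (y |` b)%fset.
Proof.
move=> sb yb; have yt := stacked_boundary sb yb; case: sb => b0 sb.
have bU : (b `<=` y |` b)%fset by exact: fsubsetU1.
split => [u|x]; first by rewrite !inE b0 orbT.
rewrite !inE => /orP[/eqP ->|/sb xt]; last first.
  exact: leq_trans xt (le_first_empty_layer bU).
move: yt; rewrite leq_eqVlt => /orP[/eqP yt|yt]; last first.
  exact: leq_trans yt (le_first_empty_layer bU).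
rewrite yt; apply: (lt_first_empty_layer_add (u := y.1) bU).
by rewrite -yt -surjective_pairing fset1U1.
Qed.

Lemma stacked_layer0 : (0 < #|V|)%N -> stacked (layer V 0).
Proof.
move=> /card_gt0P[v _]; have l0 u : (u, 0%N) \in layer V 0 by apply/imfsetP; exists u.
split => // x /imfsetP[u _ ->] /=; apply: lt_first_empty_layer => i.
by rewrite leqn0 => /eqP ->; exists u.
Qed.

Lemma layer0_first_empty : (0 < #|V|)%N -> top (layer V 0) = 1%N.
Proof.
move=> V0; have [l0 _] := stacked_layer0 V0; apply/eqP; rewrite eqn_leq.
apply/andP; split; last first.
  apply: lt_first_empty_layer => i; rewrite leqn0 => /eqP ->.
  by move/card_gt0P: V0 => [v _]; exists v.
rewrite leqNgt; apply/negP => /layer_occupied[u /imfsetP[v _ []]] //.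
Qed.

Lemma stopped_row b v j : (v, j) \in b -> stopped e b v j.+1.
Proof.
move=> vb; rewrite /stopped; case: (boolP (_ \in b)) => //= vb'.
apply/asboolP; split => //; exists (v, j) => //.
by rewrite /cyl_adj /= eqxx !eqxx orbT orbT.
Qed.

Lemma card_stopped_row b j : (count_above b j <=
  #|[pred v | stopped e b v j.+1]| + count_above b j.+1)%N.
Proof.
apply: leq_trans (count_above_row b j) _; rewrite leq_add2r.
by apply: subset_leq_card; apply/fintype.subsetP => v; rewrite !inE; exact: stopped_row.
Qed.

(** A stopped site lies in the cluster or next to a particle of layer [i.-1], [i] or [i.+1], none of
    them below [j]. Layer [i] accounts for [d + 1] sites per particle, each of the other two for
    one. *)
Lemma card_stopped d b i j : regular_graph e d -> symmetric e -> (j < i)%N ->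
  (#|[pred v | stopped e b v i]| <= (d + 3) * count_above b j)%N.
Proof.
move=> er es ji.
pose S : {set V} := [set v | (v, i) \in b]; pose S1 : {set V} := [set v | (v, i.+1) \in b].
pose S2 : {set V} := [set v | (v, i.-1) \in b].
pose N := (\bigcup_(u in S) [set v | e u v])%SET.
have sub : (#|[pred v | stopped e b v i]| <= #|N :|: S :|: S1 :|: S2|)%N.
  apply: subset_leq_card; apply/fintype.subsetP => v; rewrite !inE.
  rewrite /stopped => /orP[->|/asboolP [_ [[u k] ub]]]; first by rewrite orbT.
  rewrite /cyl_adj /= => /orP[/andP[/eqP ki uv]|/andP[/orP[/eqP ki|/eqP ki] /eqP uv]].
  - by apply/orP; left; apply/orP; left; apply/orP; left; apply/bigcupP; exists u; rewrite inE// -ki.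
  - by rewrite -uv -ki ub orbT.
  - by rewrite -uv ki /= ub !orbT.
apply: leq_trans sub _.
have cS : (#|S| <= count_above b j)%N.
  by rewrite cardsE; apply: leq_trans (card_row_le b (ltnW ji)).
have cS1 : (#|S1| <= count_above b j)%N.
  by rewrite cardsE; apply: leq_trans (card_row_le b (leqW (ltnW ji))).
have cS2 : (#|S2| <= count_above b j)%N.
  rewrite cardsE; apply: leq_trans (card_row_le b (_ : j <= i.-1)%N) => //; lia.
have cN : (#|N| <= d * #|S|)%N.
  rewrite /N mulnC -sum_nat_const.
  apply: leq_trans (_ : \sum_(u in S) #|[set v | e u v]%SET| <= _)%N; last first.
    by apply: leq_sum => u _; rewrite er.
  elim/big_rec2: _ => [|u y1 y2 _ h]; first by rewrite cards0.
  by apply: leq_trans (leq_card_setU _ _) _; rewrite leq_add2l.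
apply: (@leq_trans (#|N| + #|S| + #|S1| + #|S2|)).
  by do 3![rewrite (leq_trans (leq_card_setU _ _))// leq_add2r].
have cN' : (#|N| <= d * count_above b j)%N.
  by apply: leq_trans cN _; rewrite leq_mul2l cS orbT.
rewrite mulnDl; move: cN' cS cS1 cS2; move: #|N| #|S| #|S1| #|S2| (count_above b j) (d * _)%N.
by lia.
Qed.

End clusters.

(** * Sticking probabilities seen from a cluster *)

Section reach.
Variables (R : realType) (V : finType) (e : rel V) (d : nat).
Hypothesis e_sym : symmetric e.
Hypothesis e_irr : irreflexive e.
Hypothesis e_reg : regular_graph e d.
Hypothesis V_gt0 : (0 < #|V|)%N.
Local Notation top := first_empty_layer.

Lemma reach_layer b j : (0 < j <= top b)%N ->
  reach d e b (fun _ i => (j <= i)%N) (#|[pred v | stopped e b v j]|%:R / #|V|%:R : R).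
Proof.
move=> jb eps eps0.
have [k kP] := hit_prob_layer e_sym e_reg (stop := stopped e b)
  (target := fun _ i => (j <= i)%N) jb eps0 (fun _ _ h _ => h).
have n0 : 0 < #|V|%:R :> R by rewrite ltr0n.
exists k; rewrite ler_pdivlMr// mulrBl divfK ?gt_eqF//; apply: le_trans kP.
rewrite mulrBl mul1r lerD2l lerN2 ler_pM2l// ler_nat.
exact: max_card.
Qed.

Lemma reach_tip b L K m (H : R) : (2 <= d)%N -> stacked b -> (0 < L <= top b)%N ->
  ((d + 3) * count_above b (top b - L) <= K)%N ->
  8 * (d%:R + 2) * L%:R ^+ 2 * K%:R <= #|V|%:R :> R ->
  (0 < m)%N ->
  (forall u v s, (m <= s)%N -> (2 * #|V|%:R)^-1 <= lazy_prob R e s v u) ->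
  0 < H -> 2 * (1 + 3 * m%:R) <= H ^+ 2 -> 8 * H <= L%:R ->
  exists v0, reach d e b (fun v i => (v == v0) && (i == top b))
    (L%:R / (32 * H) / #|V|%:R).
Proof.
move=> d2 sb /andP[L0 Lb] bK Ksmall m0 mix H0 Hm HL.
(* The tip is the site on top of a particle in the highest occupied layer. *)
have [|v0 v0b] := @layer_occupied _ b (top b).-1.
  by rewrite ltn_predL; apply: leq_trans L0 Lb.
have t0 : (0 < top b)%N by apply: leq_trans L0 Lb.
have tip : stopped e b v0 (top b) by rewrite -(prednK t0); exact: stopped_row.
have above v i : (top b < i)%N -> ~~ stopped e b v i.
  move=> ib; rewrite /stopped negb_or; apply/andP; split.
    by apply/negP => /(proj2 sb) /=; lia.
  by apply/asboolP => /(stacked_boundary sb) /=; lia.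
have cst i : (top b < i + L)%N -> (#|[pred v | stopped e b v i]| <= K)%N.
  by move=> ib; apply: leq_trans (card_stopped b e_reg e_sym _) bK; lia.
have [k kP] := hit_prob_tip e_sym e_irr e_reg d2 Lb tip above cst Ksmall m0 mix H0 Hm HL.
exists v0 => eps eps0; exists k.
have n0 : 0 < #|V|%:R :> R by rewrite ltr0n.
apply: (@le_trans _ _ (L%:R / (32 * H) / #|V|%:R)); first by rewrite gerBl ltW.
by rewrite ler_pM2r ?invr_gt0.
Qed.

End reach.

(** * The Lyapunov function and its decrease *)

Section potential.
Variables (R : realType) (V : finType) (e : rel V) (d : nat).
Hypothesis e_sym : symmetric e.
Hypothesis e_irr : irreflexive e.
Hypothesis e_reg : regular_graph e d.
Hypothesis d_ge2 : (2 <= d)%N.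
Hypothesis V_gt0 : (0 < #|V|)%N.
Variables (q L m : nat) (y H : R).
Hypothesis y_gt0 : 0 < y.
Hypothesis q_ge2 : (2 <= q)%N.
Hypothesis y_le_q : y <= q%:R.
Hypothesis L_gt0 : (0 < L)%N.
Hypothesis qL_le : (q ^ L <= #|V|)%N.
Hypothesis qL_small : 8 * (d%:R + 2) * L%:R ^+ 2 * ((d + 3) * q ^ L)%:R <= #|V|%:R :> R.
Hypothesis m_gt0 : (0 < m)%N.
Hypothesis mixed : forall u v s, (m <= s)%N -> (2 * #|V|%:R)^-1 <= lazy_prob R e s v u.
Hypothesis H_gt0 : 0 < H.
Hypothesis H_mix : 2 * (1 + 3 * m%:R) <= H ^+ 2.
Hypothesis H_le : 8 * H <= L%:R.
Hypothesis H_le_y : 16 * H * y <= L%:R.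

Local Notation cluster := {fset V * nat}.
Local Notation top := first_empty_layer.
Implicit Types b : cluster.
Let n : R := #|V|%:R.
Let n_gt0 : 0 < n. Proof. by rewrite /n ltr0n. Qed.
Let q_gt0 : 0 < q%:R :> R. Proof. by rewrite ltr0n; apply: leq_trans q_ge2. Qed.

(* When the layer at depth k + 1 is crowded and fewer than q ^ k particles lie
   above it, each new particle lands above it with probability at least
   q ^ k.+1 / (2 * n): hence the weight of each of the missing particles. *)
Definition fill_time b : R :=
  \sum_(1 <= k < L) 2 * n / q%:R ^+ k.+1 * (q ^ k - count_above b (top b - k))%N%:R.

Definition max_fill_time : R := 2 * n * L%:R / q%:R.

(** Each layer left to open is charged [2 * n / y] for its opening, and [max_fill_time] because the
    opening may raise [fill_time] up to that bound. *)
Definition potential (h : nat) b : R :=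
  if (top b <= h)%N
  then (2 * n / y + max_fill_time) * (h.+1 - top b)%N%:R + fill_time b else 0.

Let coef_ge0 k : 0 <= 2 * n / q%:R ^+ k.
Proof. by rewrite divr_ge0 ?exprn_ge0// mulr_ge0// ltW. Qed.

Lemma fill_time_ge0 b : 0 <= fill_time b.
Proof. by apply: sumr_ge0 => k _; rewrite mulr_ge0. Qed.

Lemma max_fill_time_ge0 : 0 <= max_fill_time.
Proof. by rewrite divr_ge0// !mulr_ge0// ltW. Qed.

Lemma fill_time_le b : fill_time b <= max_fill_time.
Proof.
apply: (@le_trans _ _ (\sum_(1 <= k < L) 2 * n / q%:R)).
  apply: ler_sum => k _; apply: (@le_trans _ _ (2 * n / q%:R ^+ k.+1 * (q ^ k)%:R)).
    by rewrite ler_wpM2l// ler_nat leq_subr.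
  by rewrite natrX exprS invfM mulrA -!mulrA mulVf ?mulr1// expf_neq0// gt_eqF.
rewrite sumr_const_nat /max_fill_time -[leLHS]mulr_natr [leLHS]mulrAC.
rewrite ler_wpM2r ?invr_ge0// ler_wpM2l ?ler_nat ?leq_subr//.
by rewrite mulr_ge0// ltW.
Qed.

Lemma potential_ge0 h b : 0 <= potential h b.
Proof.
rewrite /potential; case: ifP => // _; rewrite addr_ge0 ?fill_time_ge0//.
by rewrite mulr_ge0// addr_ge0 ?max_fill_time_ge0// divr_ge0 ?mulr_ge0// ltW.
Qed.

Lemma le_fill_time b b' : (b `<=` b')%fset -> top b = top b' ->
  fill_time b' <= fill_time b.
Proof.
move=> bb' tb; apply: ler_sum => k _; rewrite ler_wpM2l// ler_nat -tb.
by rewrite leq_sub2l// le_count_above.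
Qed.

Lemma fill_time_drop b b' k : (b `<=` b')%fset -> top b = top b' ->
  (0 < k < L)%N -> (count_above b (top b - k) < q ^ k)%N ->
  (count_above b (top b - k) < count_above b' (top b - k))%N ->
  fill_time b' + 2 * n / q%:R ^+ k.+1 <= fill_time b.
Proof.
move=> bb' tb kL cq cc'; have kin : k \in index_iota 1 L by rewrite mem_index_iota.
rewrite /fill_time [X in _ <= X](bigD1_seq k) ?iota_uniq//=.
rewrite [X in X + _ <= _](bigD1_seq k) ?iota_uniq//= addrAC lerD//.
  rewrite -[X in _ + X]mulr1 -mulrDr ler_wpM2l// natr1 ler_nat -tb.
  by move: cq cc'; set c := count_above b _; set c' := count_above b' _; move: (q ^ k)%N c c' => p c c'; clear; lia.
apply: ler_sum => i _; rewrite ler_wpM2l// ler_nat -tb.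
by rewrite leq_sub2l// le_count_above.
Qed.

Lemma potential_top h b b' : (b `<=` b')%fset -> (top b <= h)%N ->
  (top b < top b')%N -> potential h b' + 2 * n / y <= potential h b.
Proof.
move=> bb' bh bb; rewrite /potential bh.
have m0 := max_fill_time_ge0; have f0 := fill_time_ge0 b; have fl := fill_time_le b'.
have c0 : 0 <= 2 * n / y by rewrite divr_ge0 ?mulr_ge0// ltW.
have c1 : 0 <= 2 * n / y + max_fill_time by rewrite addr_ge0.
case: ifP => [b'h|_].
  have : (2 * n / y + max_fill_time) * ((h.+1 - top b')%N%:R + 1) <=
      (2 * n / y + max_fill_time) * (h.+1 - top b)%N%:R.
    rewrite ler_wpM2l// natr1 ler_nat; move: (top b) (top b') bb b'h => t t'; clear; lia.
  by rewrite mulrDr mulr1; lra.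
have : (2 * n / y + max_fill_time) * 1 <= (2 * n / y + max_fill_time) * (h.+1 - top b)%N%:R.
  by rewrite ler_wpM2l// ler1n subn_gt0 ltnS.
by rewrite mulr1; lra.
Qed.

Lemma le_potential h b b' : (b `<=` b')%fset -> potential h b' <= potential h b.
Proof.
move=> bb'; have := le_first_empty_layer bb'; rewrite leq_eqVlt => /orP[/eqP tb|tb].
  by rewrite /potential -tb; case: ifP => // _; rewrite lerD2l le_fill_time.
have [bh|bh] := leqP (top b) h.
  have := potential_top bb' bh tb.
  by apply: le_trans; rewrite lerDl divr_ge0 ?mulr_ge0// ltW.
by rewrite {1}/potential ifF ?potential_ge0//; apply/negbTE; rewrite -ltnNge (ltn_trans bh).
Qed.

(** One particle lowers the potential by at least [p * D >= 1] on average. The cases are: no full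
    depth, full depth 1, smallest full depth at least 2. *)
Lemma potential_drop h b : stacked b -> (top b <= h)%N ->
  exists target p D, [/\ 0 <= D, 1 <= p * D, reach d e b target p &
    forall x, boundary e b x -> target x.1 x.2 ->
      potential h (x |` b)%fset + D <= potential h b].
Proof.
move=> sb bh.
have bU x : (b `<=` x |` b)%fset by exact: fsubsetU1.
have D0 : 0 <= 2 * n / y by rewrite divr_ge0 ?mulr_ge0// ltW.
have count0 : (#|V| <= count_above b 0)%N.
  rewrite (leq_trans _ (card_row_le b (leqnn 0)))//.
  by apply: subset_leq_card; apply/fintype.subsetP => v _; rewrite inE (proj1 sb).
have top0 : (0 < top b)%N.
  by apply: lt_first_empty_layer => i; rewrite leqn0 => /eqP ->;
    move/card_gt0P: V_gt0 => [v _]; exists v; exact: (proj1 sb).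
have above0 : count_above b (top b) = 0%N.
  apply/eqP; rewrite cardfs_eq0; apply/eqP/fsetP => x; rewrite !inE.
  by apply/negbTE/negP => /andP[/(proj2 sb)]; rewrite ltnNge => /negP.
pose full k := (0 < k <= L)%N && (q ^ k <= count_above b (top b - k))%N.
have [full_k|nfull] := pselect (exists k, full k); last first.
  have small k : (0 < k <= L)%N -> (count_above b (top b - k) < q ^ k)%N.
    by move=> kL; rewrite ltnNge; apply/negP => qk; apply: nfull; exists k; rewrite /full kL.
  have Lsmall := small L; rewrite L_gt0 leqnn in Lsmall; have {}Lsmall := Lsmall isT.
  (* Otherwise the particles counted at depth [L] include the [#|V| >= q ^ L] ones of layer 0. *)
  have Ltop : (L <= top b)%N.
    rewrite leqNgt; apply/negP => /ltnW; rewrite -subn_eq0 => /eqP t0.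
    by move: Lsmall; rewrite t0 ltnNge (leq_trans qL_le).
  have K1 : ((d + 3) * count_above b (top b - L) <= (d + 3) * q ^ L)%N.
    by rewrite leq_mul2l ltnW// orbT.
  have Lr : (0 < L <= top b)%N by rewrite L_gt0.
  have [v0 v0P] := reach_tip e_sym e_irr e_reg V_gt0 d_ge2 sb Lr K1 qL_small m_gt0
    mixed H_gt0 H_mix H_le.
  exists (fun v i => (v == v0) && (i == top b)), (L%:R / (32 * H) / n), (2 * n / y).
  split=> //.
    rewrite [X in 1 <= X](_ : _ = L%:R / (16 * H * y)); last first.
      by field; rewrite !gt_eqF// ltr0n.
    by rewrite ler_pdivlMr ?mul1r ?mulr_gt0.
  move=> [v i] _ /= /andP[/eqP -> /eqP ->]; apply: potential_top => //.
  by apply: (lt_first_empty_layer_add (u := v0) (bU _)); rewrite fset1U1.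
case: (ex_minnP full_k) => -[//|k] /andP[/andP[_ kL] fk] mink.
case: k kL fk mink => [|k] kL fk mink.
  (* Depth 1 is full: at least [q >= y] sites of layer [top b] are stopped. *)
  have := card_stopped_row e b (top b).-1; rewrite prednK// above0 addn0.
  rewrite -subn1 => /(leq_trans fk); rewrite expn1 => qc.
  have tr : (0 < top b <= top b)%N by rewrite top0 /=.
  have rl := @reach_layer R V e d e_sym e_reg V_gt0 b _ tr.
  exists (fun _ i => (top b <= i)%N), (#|[pred v | stopped e b v (top b)]|%:R / n), (2 * n / y).
  split=> //.
    rewrite [X in 1 <= X](_ : _ = 2 * #|[pred v | stopped e b v (top b)]|%:R / y); last first.
      by field; rewrite !gt_eqF// ltr0n.
    rewrite ler_pdivlMr// mul1r (le_trans y_le_q)//.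
    have : q%:R <= #|[pred v | stopped e b v (top b)]|%:R :> R by rewrite ler_nat.
    by have := ltW q_gt0; lra.
  move=> [v i] vb /= ti; apply: potential_top => //.
  apply: (lt_first_empty_layer_add (u := v) (bU _)).
  have := stacked_boundary sb vb => /= it.
  have -> : top b = i by apply/eqP; rewrite eqn_leq ti.
  exact: fset1U1.
(* The smallest full depth is now [k.+2], so depth [k.+1] is not full. The layer [j] at depth [k.+1]
   then has at least [q ^ k.+2 - q ^ k.+1] stopped sites, and [q >= 2] makes this half of [q ^ k.+2]
   or more. *)
have kk : (count_above b (top b - k.+1) < q ^ k.+1)%N.
  rewrite ltnNge; apply/negP => qk.
  have /mink : full k.+1 by rewrite /full qk /= ltnW.
  by rewrite ltnn.
have kt : (k.+1 < top b)%N.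
  rewrite ltnNge; apply/negP; rewrite -subn_eq0 => /eqP t0.
  move: kk; rewrite t0 ltnNge (leq_trans _ count0)// (leq_trans _ qL_le)//.
  by rewrite leq_exp2l// ltnW.
set j := (top b - k.+1)%N; have j0 : (0 < j)%N by rewrite subn_gt0.
have jS : (top b - k.+2)%N = j.-1 by rewrite /j subnS.
have := card_stopped_row e b j.-1; rewrite prednK//.
rewrite -jS => /(leq_trans fk) => qc.
have jr : (0 < j <= top b)%N by rewrite j0 leq_subr.
have rl := @reach_layer R V e d e_sym e_reg V_gt0 b _ jr.
exists (fun _ i => (j <= i)%N), (#|[pred v | stopped e b v j]|%:R / n),
  (2 * n / q%:R ^+ k.+2).
split=> //.
  rewrite [X in 1 <= X](_ : _ = 2 * #|[pred v | stopped e b v j]|%:R / q%:R ^+ k.+2); last first.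
    have qn : q%:R != 0 :> R by rewrite gt_eqF.
    by field; rewrite ?expf_neq0 // gt_eqF// ltr0n.
  rewrite ler_pdivlMr ?exprn_gt0// mul1r -natrX -natrM ler_nat.
  move: qc kk; rewrite -/j [(q ^ k.+2)%N]expnS.
  have : (2 * q ^ k.+1 <= q * q ^ k.+1)%N by rewrite leq_mul2r q_ge2 orbT.
  by move: (q * q ^ k.+1)%N (q ^ k.+1)%N (count_above b j) #|_| => x1 x2 x3 x4; clear; lia.
move=> x xb jx; have := le_first_empty_layer (bU x).
rewrite leq_eqVlt => /orP[/eqP tE|tb].
  have xb' : x \notin b by case: xb.
  have := @fill_time_drop b (x |` b)%fset k.+1 (bU x) tE _ kk _.
  rewrite /potential -tE bh -addrA lerD2l; apply => //.
  by rewrite count_aboveU1.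
(* If a layer is opened instead, the drop [2 * n / y] suffices because [y <= q <= q ^ k.+2]. *)
apply: le_trans (potential_top (bU x) bh tb); rewrite lerD2l ler_wpM2l ?mulr_ge0 ?(ltW n_gt0)//.
rewrite lef_pV2 ?posrE ?exprn_gt0// (le_trans y_le_q)// -natrX ler_nat.
by rewrite -[X in (X <= _)%N]expn1 leq_exp2l.
Qed.

End potential.

(** The first time equals the number of times before it; expectations of first times thus become
    sums of probabilities. *)
Lemma first_time_series (R : realType) (S : pred nat) :
  (forall t, S t -> S t.+1) ->
  first_time R [set t | S t]%classic =
  (\sum_(0 <= t <oo) ((~~ S t)%:R : R)%:E)%E.
Proof.
move=> S_up.
have f0 k : (0 <= ((~~ S k)%:R : R)%:E)%E by rewrite lee_fin.
have [exS|nS] := pselect (exists t, S t); last first.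
  have S0 t : S t = false by apply/negP => St; apply: nS; exists t.
  rewrite /first_time (_ : [set t | S t]%classic = set0); last first.
    by apply/seteqP; split => t //=; rewrite S0.
  rewrite image_set0 ereal_inf0; apply/esym/eqyP => r _.
  pose k := Num.Def.archi_bound `|r|.
  apply: le_trans (nneseries_lim_ge k _) => //.
  rewrite (eq_bigr (fun=> 1%:E)) => [|t _]; last by rewrite S0.
  rewrite sumEFin lee_fin sumr_const_nat subn0.
  rewrite (le_trans (ler_norm r))// ltW// /k.
  by have := archi_boundP (normr_ge0 r).
case: (ex_minnP exS) => t0 St0 min_t0.
have S_ge t : (t0 <= t)%N -> S t.
  elim: t => [|t IH]; first by rewrite leqn0 => /eqP <-.
  by rewrite leq_eqVlt => /orP[/eqP <-//|/IH]; exact: S_up.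
have -> : (\sum_(0 <= t <oo) ((~~ S t)%:R : R)%:E)%E = (t0%:R)%:E.
  rewrite (@nneseries_split _ _ 0 t0)// add0n eseries0 ?adde0; last first.
    by move=> t tt _; rewrite S_ge.
  rewrite big_nat_cond (eq_bigr (fun=> 1%:E)) -?big_nat_cond.
    by rewrite sumEFin sumr_const_nat subn0.
  move=> t; rewrite andbT => /= tt; have -> // : S t = false.
  by apply/negP => /min_t0; rewrite leqNgt tt.
apply/eqP; rewrite eq_le; apply/andP; split.
  by apply: ereal_inf_lbound; exists t0.
by apply: le_ereal_inf_tmp => _ [t St <-]; rewrite lee_fin ler_nat min_t0.
Qed.

(** * Drift argument for the expected opening time *)

Section process.
Variables (R : realType) (d : nat) (disp : measure_display) (Omega : measurableType disp).
Variables (P : probability Omega R) (V : finType) (e : rel V).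
Variables (A : nat -> Omega -> {fset V * nat}) (X : nat -> nat -> Omega -> V * nat).
Hypothesis e_sym : symmetric e.
Hypothesis e_reg : regular_graph e d.
Hypothesis V_gt0 : (0 < #|V|)%N.
Hypothesis cdla : cylinder_DLA P e A X.
Local Notation cluster := {fset V * nat}.
Local Notation top := first_empty_layer.
Local Notation pr := (prob P).
Local Open Scope classical_set_scope.

Lemma measurable_cluster_fun (D : set Omega) t (f : cluster -> \bar R) :
  measurable_fun D ((fun w => f (A t w)) : Omega -> \bar R).
Proof.
move=> mD Y mY; apply: measurableI => //.
by apply: (measurable_fibers (f := A t) (fun b => Y (f b))) => b;
  exact: (cdla_measurable_cluster cdla).
Qed.

Lemma cluster_after_hit t a target w : history A t a w ->
  hits e X t (a t) target w ->
  exists2 x, boundary e (a t) x /\ target x.1 x.2 & A t.+1 w = (x |` a t)%fset.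
Proof.
move=> hw [r [hr tr]]; exists (X t.+1 r w); first by split => //; case: hr.
by rewrite (cdla_step cdla (r := r)) hw.
Qed.

(** The next cluster is prescribed only when the walk hits the boundary. Layer 0 being full, all of
    layer 1 is stopped, so the walk hits almost surely, and a history of positive probability
    contains an outcome where it does. *)
Lemma stacked_history t a : 0 < pr (history A t a) -> stacked (a t).
Proof.
have mh s := measurable_history cdla s a.
have h0 t' : 0 < pr (history A t' a) -> exists w, history A t' a w.
  move=> p0; apply/set0P/negP => /eqP h0; move: p0.
  by rewrite h0 /prob measure0 ltxx.
elim: t => [|t IH] p0.
  by have [w /(_ 0%N (leqnn _)) <-] := h0 _ p0; rewrite (cdla_init cdla); exact: stacked_layer0.
have sub : history A t.+1 a `<=` history A t a by move=> w hw s st; rewrite hw// leqW.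
have {}IH : stacked (a t) by apply: IH; apply: lt_le_trans p0 (le_prob _ _ _ sub).
have top_gt0 : (0 < top (a t))%N.
  apply: lt_first_empty_layer => i; rewrite leqn0 => /eqP ->.
  by move/card_gt0P: V_gt0 => [v _]; exists v; exact: (proj1 IH).
have jr : (0 < 1 <= top (a t))%N by [].
have := @reach_layer R V e d e_sym e_reg V_gt0 (a t) _ jr.
rewrite (_ : #|_| = #|V|); last first.
  by apply: eq_card => v; rewrite !inE stopped_row// (proj1 IH).
rewrite divff ?pnatr_eq0 -?lt0n// => /(reach_hits e_sym e_reg cdla) hit.
have [[w [hw wh]]|nw] := pselect (exists w, history A t.+1 a w /\
    hits e X t (a t) (fun _ i => (1 <= i)%N) w).
  have [x [xb _] xE] := cluster_after_hit (sub _ hw) wh.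
  by rewrite -(hw t.+1)// xE; exact: (stacked_add IH xb).
(* Without such an outcome, the history up to [t.+1] is disjoint from a hit event that carries the
   full probability of the history up to [t]. *)
suff : pr (history A t.+1 a) + pr (history A t a `&` hits e X t (a t) (fun _ i => (1 <= i)%N))
    <= pr (history A t a).
  by move: hit p0; rewrite mulr1; lra.
have mhh : measurable (history A t a `&` hits e X t (a t) (fun _ i => (1 <= i)%N)).
  by apply: measurableI => //; exact: (measurable_hits cdla).
rewrite -lee_fin EFinD -!probE// -measureU//; last first.
  by apply/seteqP; split => // w [hw [_ wh]]; apply: nw; exists w.
by apply: le_measure; rewrite ?inE//; [exact: measurableU|move=> w [/sub|[]]].
Qed.

(** Clusters form a countable type, so the histories up to [t] cut the space into countably many
    measurable events, coded by [pickle]. *)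
Lemma le_integral_history t (F G : Omega -> \bar R) :
  measurable_fun setT F -> measurable_fun setT G ->
  (forall w, 0 <= F w)%E -> (forall w, 0 <= G w)%E ->
  (forall a, \int[P]_(w in history A t a) F w <= \int[P]_(w in history A t a) G w)%E ->
  (\int[P]_w F w <= \int[P]_w G w)%E.
Proof.
move=> mF mG F0 G0 FG.
pose code w := choice.pickle (mkseq (fun s => A s w) t.+1).
pose H k := [set w | code w = k].
have HE w0 : H (code w0) = history A t (fun s => A s w0).
  apply/seteqP; split => w /=.
    move=> /(pcan_inj choice.pickleK) cw s st.
    have := congr1 (fun r => nth fset0 r s) cw.
    by rewrite !nth_mkseq.
  move=> hw; congr choice.pickle; apply/eq_in_map => s.
  by rewrite mem_iota add0n ltnS => /andP[_ st]; rewrite hw.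
have H0 k : (exists w0, k = code w0) \/ H k = set0.
  have [[w0 Hw0]|nH] := pselect (exists w, H k w); first by left; exists w0.
  by right; apply/seteqP; split => w// Hw; apply: nH; exists w.
have mH k : measurable (H k).
  have [[w0 ->]|->//] := H0 k; rewrite HE; exact: (measurable_history cdla).
have TE : [set: Omega] = \bigcup_k H k.
  by apply/seteqP; split => // w _; exists (code w).
have tH : trivIset setT H by move=> i j _ _ [w [<- <-]].
rewrite TE !ge0_integral_bigcup//; try by rewrite -TE.
apply: lee_nneseries => k _; first by move=> _; apply: integral_ge0.
by have [[w0 ->]|->] := H0 k; [rewrite HE; exact: FG | rewrite !integral_set0].
Qed.

Section drift.
Variables (h : nat) (Phi : cluster -> R).
Hypothesis Phi_ge0 : forall b, 0 <= Phi b.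
Hypothesis le_Phi : forall b b', (b `<=` b')%fset -> Phi b' <= Phi b.
Hypothesis Phi_drop : forall b, stacked b -> (top b <= h)%N ->
  exists target p D, [/\ 0 <= D, 1 <= p * D, reach d e b target p &
    forall x, boundary e b x -> target x.1 x.2 -> Phi (x |` b)%fset + D <= Phi b].

Let below (b : cluster) : R := (top b <= h)%N%:R.

(** Given the history, [Phi] never grows, and it drops by [D] with conditional probability at least
    [p]; as [p * D >= 1], this pays for the unit [below]. *)
Lemma history_drift t a :
  (\int[P]_(w in history A t a) (Phi (A t.+1 w) + below (A t w))%:E
   <= \int[P]_(w in history A t a) (Phi (A t w))%:E)%E.
Proof.
set Ha := history A t a; have mH : measurable Ha := measurable_history cdla t a.
have AE w : Ha w -> A t w = a t by apply.
have int_cst (c : R) : (\int[P]_(w in Ha) cst c%:E w = (c * pr Ha)%:E)%E.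
  by rewrite integral_cst// EFinM; congr (_ * _)%E; exact: probE.
have Phi_next w : Ha w -> Phi (A t.+1 w) <= Phi (a t).
  by move=> /AE <-; apply: le_Phi; exact: (cdla_increasing cdla).
have mPhi : measurable_fun Ha (fun w => (Phi (A t w))%:E).
  exact: (@measurable_cluster_fun Ha t (fun b => (Phi b)%:E)).
have mPhi1 : measurable_fun Ha (fun w => (Phi (A t.+1 w) + below (A t w))%:E).
  under eq_fun do rewrite EFinD; apply: emeasurable_funD.
    exact: (@measurable_cluster_fun Ha t.+1 (fun b => (Phi b)%:E)).
  exact: (@measurable_cluster_fun Ha t (fun b => (below b)%:E)).
have ge1 w : Ha w -> (0 <= (Phi (A t.+1 w) + below (A t w))%:E)%E.
  by move=> _; rewrite lee_fin addr_ge0.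
have [ah|ah] := leqP (top (a t)) h; last first.
  apply: ge0_le_integral => // w Hw.
  by rewrite lee_fin /below (AE _ Hw) leqNgt ah addr0 Phi_next.
have -> : (\int[P]_(w in Ha) (Phi (A t w))%:E = (Phi (a t) * pr Ha)%:E)%E.
  rewrite (eq_integral (cst (Phi (a t))%:E)); last first.
    by move=> w; rewrite inE => Hw; rewrite (AE _ Hw).
  exact: int_cst.
have below1 w : Ha w -> below (A t w) = 1 by move=> Hw; rewrite /below (AE _ Hw) ah.
(* On a null history both sides vanish; only the other histories are known to be [stacked]. *)
have [p0|p0] := leP (pr Ha) 0.
  have pr0 : pr Ha = 0 by apply: le_anti; rewrite p0 prob_ge0.
  rewrite pr0 mulr0; apply: (@le_trans _ _ (\int[P]_(w in Ha) cst (Phi (a t) + 1)%:E w)%E).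
    apply: ge0_le_integral => //.
    by move=> w Hw; rewrite lee_fin (below1 _ Hw) lerD2r Phi_next.
  by rewrite int_cst pr0 mulr0.
have sa := stacked_history p0.
have [target [p [D [D0 pD rp dropD]]]] := Phi_drop sa ah.
have hit := reach_hits e_sym e_reg cdla rp; rewrite -/Ha in hit.
set E := hits e X t (a t) target in hit.
have mE : measurable E := measurable_hits cdla t (a t) target.
have mHE : measurable (Ha `&` E) by exact: measurableI.
have ind0 w : 0 <= D * \1_E w :> R by rewrite mulr_ge0// indicE.
have mI : measurable_fun Ha (fun w => (D * \1_E w)%:E).
  apply/measurable_EFinP; apply: measurable_funM; first exact: measurable_cst.
  exact: measurable_indic.
(* The gain stays on the left as [D * \1_E], so that only nonnegative functions are integrated; it
   is cancelled at the end. *)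
have : (\int[P]_(w in Ha) ((Phi (A t.+1 w) + below (A t w))%:E + (D * \1_E w)%:E)
   <= \int[P]_(w in Ha) cst (Phi (a t) + 1)%:E w)%E.
  apply: ge0_le_integral => //.
  - by move=> w Hw; rewrite adde_ge0// ?ge1// lee_fin.
  - exact: emeasurable_funD.
  move=> w Hw; rewrite -EFinD lee_fin (below1 _ Hw) indicE.
  case: (boolP (w \in E)) => wE; last first.
    by rewrite mulr0 addr0 lerD2r Phi_next.
  rewrite inE in wE; have [x [xb xt] ->] := cluster_after_hit Hw wE.
  by rewrite mulr1 addrAC lerD2r dropD.
rewrite int_cst ge0_integralD//; last by move=> w _; rewrite lee_fin.
have -> : (\int[P]_(w in Ha) (D * \1_E w)%:E = (D * pr (Ha `&` E))%:E)%E.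
  under eq_integral do rewrite EFinM.
  rewrite ge0_integralZl//.
  - by rewrite integral_indic// setIC EFinM; congr (_ * _)%E; exact: probE.
  - by apply/measurable_EFinP; exact: measurable_indic.
move=> le1.
have : (1 <= p * D -> (Phi (a t) + 1) * pr Ha <= Phi (a t) * pr Ha + D * pr (Ha `&` E)).
  move=> _; rewrite mulrDl mul1r lerD2l.
  apply: (@le_trans _ _ (D * (pr Ha * p))); last by rewrite ler_wpM2l.
  by rewrite mulrCA [D * p]mulrC ler_peMr// ltW.
move=> /(_ pD); rewrite -lee_fin EFinD => /(le_trans le1).
by rewrite leeD2rE.
Qed.

(** The drift telescopes over [t]. Layer [h] can be empty only while [top <= h], so the time is at
    most the number of such [t]. *)
Lemma expected_layer_time :
  (\int[P]_w layer_time R A h w <= (Phi (layer V 0))%:E)%E.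
Proof.

pose u t := (\int[P]_w (Phi (A t w))%:E)%E.
pose v t := (\int[P]_w (below (A t w))%:E)%E.
have mPhi t : measurable_fun setT (fun w => (Phi (A t w))%:E).
  exact: (@measurable_cluster_fun setT t (fun b => (Phi b)%:E)).
have mbelow t : measurable_fun setT (fun w => (below (A t w))%:E).
  exact: (@measurable_cluster_fun setT t (fun b => (below b)%:E)).
have v0 t : (0 <= v t)%E by apply: integral_ge0 => w _; rewrite lee_fin.
have u0 t : (0 <= u t)%E by apply: integral_ge0 => w _; rewrite lee_fin.
have step t : (u t.+1 + v t <= u t)%E.
  rewrite -ge0_integralD//; try by move=> w _; rewrite lee_fin.
  under eq_integral do rewrite -EFinD.
  apply: (@le_integral_history t) => [|//|w|w|a]; rewrite ?lee_fin ?addr_ge0//.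
    under eq_fun do rewrite EFinD; exact: emeasurable_funD.
  exact: history_drift.
have sumv k : (u k + \sum_(0 <= t < k) v t <= u 0%N)%E.
  elim: k => [|k IH]; first by rewrite big_geq// adde0.
  apply: le_trans IH; rewrite big_nat_recr//= [(\sum_(_ <= _ < _) _ + _)%E]addeC addeA.
  by apply: leeD2r; exact: step.
have uE : u 0%N = (Phi (layer V 0))%:E.
  rewrite /u (eq_integral (cst (Phi (layer V 0))%:E)).
    rewrite integral_cst// -[RHS]mule1; congr (_ * _)%E; exact: probability_setT.
  by move=> w _; rewrite (cdla_init cdla).
have reached t w : ((A t w `&` layer V h)%fset != fset0) ->
  ((A t.+1 w `&` layer V h)%fset != fset0).
  move=> /fset0Pn[x]; rewrite inE => /andP[xA xl]; apply/fset0Pn; exists x.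
  by rewrite inE xl andbT; have /fsubsetP := cdla_increasing cdla t w; apply.
have TE w : layer_time R A h w =
    (\sum_(0 <= t <oo) ((A t w `&` layer V h == fset0)%fset%:R : R)%:E)%E.
  have := @first_time_series R (fun t => (A t w `&` layer V h)%fset != fset0)
    (fun t => @reached t w).
  rewrite (_ : [set t | _ ] = [set t | (A t w `&` layer V h)%fset <> fset0]).
    by rewrite /layer_time => ->; apply: eq_eseriesr => t _; rewrite negbK.
  by apply/seteqP; split => t /= /eqP.
have mh t : measurable_fun setT (fun w => ((A t w `&` layer V h == fset0)%fset%:R : R)%:E).
  exact: (@measurable_cluster_fun setT t (fun b => ((b `&` layer V h == fset0)%fset%:R : R)%:E)).
under eq_integral do rewrite TE.
rewrite integral_nneseries//.
apply: (@le_trans _ _ (\sum_(0 <= t <oo) v t)%E).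
  apply: lee_nneseries => [t _ _|t _].
    by apply: integral_ge0 => w _; rewrite lee_fin.
  apply: ge0_le_integral => //.
  move=> w _; rewrite lee_fin ler_nat /below.
  case: (boolP (_ == _)) => //= /eqP Ah; rewrite lt0b leqNgt.
  apply/negP => /layer_occupied[x xh]; suff : (x, h) \in fset0 by rewrite inE.
  by rewrite -Ah inE xh; apply/imfsetP; exists x.
apply: lime_le; first by apply: is_cvg_nneseries => t _ _; exact: v0.
apply: nearW => k; rewrite -uE; apply: le_trans (sumv k).
by rewrite leeDr.
Qed.

End drift.
End process.

(** * Choice of parameters for large n *)

Section asymptotics.
Variable R : realType.

Lemma cube_le_expR (x : R) : 0 <= x -> (x / 3) ^+ 3 <= expR x.
Proof.
move=> x0; have -> : expR x = expR (x / 3) ^+ 3.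
  by rewrite -expRM_natl; congr expR; field.
by rewrite ler_pXn2r ?nnegrE ?expR_ge0 ?divr_ge0// (le_trans _ (expR_ge1Dx _))// lerDr.
Qed.

(** The infimum is below [r + 1], hence so is some element of the set; the unit of slack replaces
    attainment of the infimum. *)
Lemma mixing_time_attained (V : finType) (e : rel V) (r : R) :
  (mixing_time R e <= r%:E)%E -> exists2 m : nat, (0 < m)%N /\ m%:R < r + 1 &
    forall u v s, (m <= s)%N -> (2 * #|V|%:R)^-1 <= lazy_prob R e s v u.
Proof.
move=> mr; have : (mixing_time R e < (r + 1)%:E)%E.
  by apply: le_lt_trans mr _; rewrite lte_fin ltrDl.
by move=> /ereal_inf_lt[_ [m [m0 mix] <-]]; rewrite lte_fin => mr1; exists m.
Qed.

(** Here [l] is log n and [y] is log log n. The three thresholds on [y] give, in order,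
    [8 * y ^+ 5 <= l ^+ 2], the bound on [H], and room for the factors depending on [d]. *)
Lemma parameters (d m : nat) (l y : R) : l = expR y ->
  8 * (27 * 27) <= y -> 7 * (128 * 128) <= y ->
  24 * 24 * 24 * ((d%:R + 2) * (d%:R + 3)) <= y -> m%:R <= l ^+ 2 / y ^+ 5 + 1 ->
  exists q L : nat, exists H : R,
    [/\ (2 <= q)%N, y <= q%:R, (0 < L)%N, 2 * L%:R * y < q%:R &
     [/\ 8 * (d%:R + 2) * L%:R ^+ 2 * ((d + 3) * q ^ L)%:R <= expR l,
         0 < H, 2 * (1 + 3 * m%:R) <= H ^+ 2, 8 * H <= L%:R & 16 * H * y <= L%:R]].
Proof.
move=> lE yA yB yC mr; have dR := ler0n R d.
have y1 : 15 <= y by apply: le_trans yA; lra.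
have yA' : 0 <= y / (27 * 27) - 8 by rewrite subr_ge0 ler_pdivlMr// mulr_gt0.
have yB' : 0 <= y / (128 * 128) - 7 by rewrite subr_ge0 ler_pdivlMr// mulr_gt0.
move: yA yB => _ _.
have y0 : 0 < y by lra.
have l0 : 0 < l by rewrite lE expR_gt0.
have ly3 : (y / 3) ^+ 3 <= l by rewrite lE cube_le_expR// ltW.
have lC : 24 * 24 * 24 * ((d%:R + 2) * (d%:R + 3)) <= l.
  by apply: le_trans yC _; rewrite lE (le_trans _ (expR_ge1Dx _))// lerDr.
move: yC => _; have ly : y <= l by rewrite lE (le_trans _ (expR_ge1Dx _))// lerDr.
have l8y : 8 * y <= l.
  apply: le_trans ly3; rewrite -subr_ge0.
  rewrite [X in 0 <= X](_ : _ = y * (y ^+ 2 / 27 - 8)); last by field.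
  rewrite mulr_ge0 ?(ltW y0)// subr_ge0 ler_pdivlMr// expr2.
  have : 15 * 15 <= y * y by apply: ler_pM.
  by lra.
have l2y5 : 8 * y ^+ 5 <= l ^+ 2.
  apply: (@le_trans _ _ (((y / 3) ^+ 3) ^+ 2)); last first.
    by rewrite ler_pXn2r ?nnegrE ?exprn_ge0 ?divr_ge0 ?(ltW y0) ?(ltW l0).
  rewrite -subr_ge0 [X in 0 <= X](_ : _ = y ^+ 5 * (y / (27 * 27) - 8)); last by field.
  by rewrite mulr_ge0 ?exprn_ge0 ?(ltW y0).
(* From [q <= l ^+ 3] and [4 * y * L <= l] follows [q ^ L <= expR (3 * y * L) <= expR (3 * l / 4)],
   that is n to the power 3/4. *)
pose L := Num.truncn (l / (4 * y)); pose q := (Num.truncn (l ^+ 2)).+1.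
have y4 : 0 < 4 * y by lra.
have /andP[L1 L2] : L%:R <= l / (4 * y) < L.+1%:R.
  by apply: truncn_itv; rewrite divr_ge0// ltW.
have /andP[q1 q2] : (Num.truncn (l ^+ 2))%:R <= l ^+ 2 < q%:R.
  by apply: truncn_itv; rewrite exprn_ge0// ltW.
have q3 : q%:R <= l ^+ 3.
  rewrite /q -natr1; apply: (@le_trans _ _ (l ^+ 2 + 1)); first by rewrite lerD2r.
  have l2 : 1 <= l ^+ 2 by rewrite expr_ge1 ?(ltW l0)//; lra.
  have : 2 * l ^+ 2 <= l * l ^+ 2 by rewrite ler_pM2r ?exprn_gt0//; lra.
  by rewrite -exprS; lra.
have l_sq : l * 15 <= l ^+ 2 by rewrite expr2 ler_pM2l//; lra.
have Ll : 4 * y * L%:R <= l by rewrite mulrC -ler_pdivlMr.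
have Lge : l / (8 * y) <= L%:R.
  have : 1 <= l / (8 * y) by rewrite ler_pdivlMr ?mul1r//; lra.
  have -> : l / (8 * y) = l / (4 * y) / 2 by field; rewrite gt_eqF.
  by move: L2; rewrite -natr1; lra.
(* The smallest [H] allowed by the mixing condition. *)
pose H := Num.sqrt (2 * (1 + 3 * m%:R)) : R.
have m0 := ler0n R m.
have H2 : H ^+ 2 = 2 * (1 + 3 * m%:R) by rewrite sqr_sqrtr//; lra.
have H0 : 0 < H by rewrite sqrtr_gt0; lra.
have y5 : 0 < y ^+ 5 by rewrite exprn_gt0.
(* With [l ^+ 2 / y ^+ 5 >= 8], the square of [H] is at most [7 * l ^+ 2 / y ^+ 5]; the fifth power
   leaves one factor [y] to absorb [7 * 128 ^+ 2]. As [128 * y ^+ 2 = 16 * y * (8 * y)],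
   [16 * H * y <= L] follows. *)
have Hl : H <= l / (128 * y ^+ 2).
  rewrite -(@ler_pXn2r _ 2)// ?nnegrE ?(ltW H0)//; last first.
    by rewrite divr_ge0 ?(ltW l0)// mulr_ge0 ?exprn_ge0// ltW.
  rewrite H2; apply: (@le_trans _ _ (7 * (l ^+ 2 / y ^+ 5))).
    have : 8 <= l ^+ 2 / y ^+ 5 by rewrite ler_pdivlMr.
    by lra.
  rewrite -subr_ge0.
  rewrite [X in 0 <= X](_ : _ = (l ^+ 2 / y ^+ 5) * (y / (128 * 128) - 7)); last first.
    by field; rewrite gt_eqF.
  by rewrite mulr_ge0 ?divr_ge0 ?exprn_ge0 ?(ltW l0) ?(ltW y0).
have H16 : 16 * H * y <= L%:R.
  apply: le_trans Lge; rewrite ler_pdivlMr; last by lra.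
  have := ler_wpM2r (_ : 0 <= 128 * y ^+ 2) Hl.
  rewrite divfK ?gt_eqF ?mulr_gt0 ?exprn_gt0//.
  rewrite (_ : H * (128 * y ^+ 2) = 16 * H * y * (8 * y)); last by ring.
  by apply; rewrite mulr_ge0// exprn_ge0// ltW.
have H8 : 8 * H <= L%:R.
  by apply: le_trans H16; rewrite mulrAC ler_pM2r//; lra.
have q_ge2 : (2 <= q)%N by rewrite -(ler_nat R); lra.
have L_gt0 : (0 < L)%N.
  by rewrite -(ltr_nat R); apply: lt_le_trans Lge; rewrite divr_gt0//; lra.
have Lyq : 2 * L%:R * y < q%:R by move: Ll; lra.
have y_le_q : y <= q%:R by lra.
exists q, L, H; split=> //; split=> //; last by rewrite H2.
- have yL : 3 * y * L%:R <= 3 * l / 4 by move: Ll; lra.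
  have qL : (q ^ L)%:R <= expR (3 * l / 4) :> R.
    rewrite natrX (@le_trans _ _ ((l ^+ 3) ^+ L))//.
      by rewrite lerXn2r ?nnegrE ?exprn_ge0 ?(ltW l0).
    rewrite lE -!expRM_natl ler_expR; move: yL; lra.
  have Lsq : L%:R ^+ 2 <= l ^+ 2.
    rewrite ler_pXn2r ?nnegrE ?(ltW l0)//; apply: le_trans Ll.
    by rewrite ler_peMl//; lra.
  (* The remaining quarter of the exponent absorbs the polynomial factors; the threshold
     [24 * 24 * 24] is [8 * 12 ^+ 3]. *)
  have l12 : (l / 12) ^+ 3 <= expR (l / 4).
    apply: le_trans (cube_le_expR _); last by rewrite divr_ge0 ?(ltW l0).
    by rewrite (_ : l / 4 / 3 = l / 12)//; field.
  have -> : expR l = expR (l / 4) * expR (3 * l / 4).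
    by rewrite -expRD; congr expR; field.
  rewrite natrM mulrA ler_pM//.
  apply: le_trans l12; rewrite natrD.
  apply: (@le_trans _ _ (8 * (d%:R + 2) * (d%:R + 3) * l ^+ 2)).
    rewrite mulrAC ler_wpM2l//; by rewrite !mulr_ge0//; lra.
  rewrite -subr_ge0 [X in 0 <= X](_ : _ = l ^+ 2 / (12 * 12 * 12) *
    (l - 24 * 24 * 24 * ((d%:R + 2) * (d%:R + 3)))); last by field.
  by rewrite mulr_ge0 ?subr_ge0// divr_ge0 ?exprn_ge0 ?(ltW l0)// !mulr_ge0.
Qed.

End asymptotics.

Theorem theorem2p1 (R : realType) (d : nat) (hd : (2 <= d)%N) :
  exists n0 : nat, forall n : nat, (n0 < n)%N ->
  forall (V : finType) (e : rel V),
    simple_graph e -> connected_graph e -> regular_graph e d -> #|V| = n ->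
    (mixing_time R e <= (ln (n%:R : R) ^+ 2 / ln (ln (n%:R : R)) ^+ 5)%:E)%E ->
  forall (disp : measure_display) (Omega : measurableType disp)
    (P : probability Omega R)
    (A : nat -> Omega -> {fset V * nat}) (X : nat -> nat -> Omega -> V * nat),
    cylinder_DLA P e A X ->
  forall m : nat, (1 <= m)%N ->
    (\int[P]_w layer_time R A m w
       < (4 * m%:R * n%:R / ln (ln (n%:R : R)))%:E)%E.
Proof.
have D0 : 0 <= 24 * 24 * 24 * ((d%:R + 2) * (d%:R + 3)) :> R by rewrite !mulr_ge0.
(* Above the sum [Y] all three thresholds of [parameters] hold for log log n, hence the double
   exponential. *)
pose Y : R := 8 * (27 * 27) + 7 * (128 * 128) + 24 * 24 * 24 * ((d%:R + 2) * (d%:R + 3)).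
exists (Num.Def.archi_bound (expR (expR Y))) => n n0n V e [e_sym e_irr] _ e_reg Vn.
have nY : expR (expR Y) < n%:R.
  by apply: (lt_trans (archi_boundP (expR_ge0 _))); rewrite ltr_nat.
have n_gt0 : 0 < n%:R :> R by apply: lt_trans nY; exact: expR_gt0.
set l := ln (n%:R : R); set y := ln l => mixing disp Omega P A X cdla h h1.
have nE : n%:R = expR l by rewrite lnK.
have lY : expR Y < l by rewrite -ltr_expR -nE.
have l_gt0 : 0 < l by apply: lt_trans lY; exact: expR_gt0.
have lE : l = expR y by rewrite lnK.
have yY : Y < y by rewrite -ltr_expR -lE.
have V_gt0 : (0 < #|V|)%N by rewrite Vn -(ltr0n R).
have [m [m_gt0 mr] mixed] := @mixing_time_attained R V e _ mixing.
have Y1 : 8 * (27 * 27) <= y.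
  by apply: ltW; apply: le_lt_trans yY; rewrite /Y -addrA lerDl addr_ge0// !mulr_ge0.
have Y2 : 7 * (128 * 128) <= y.
  apply: ltW; apply: le_lt_trans yY; rewrite /Y addrAC lerDr addr_ge0// !mulr_ge0//.
have Y3 : 24 * 24 * 24 * ((d%:R + 2) * (d%:R + 3)) <= y.
  by apply: ltW; apply: le_lt_trans yY; rewrite /Y lerDr addr_ge0// !mulr_ge0.
have [q [L [H [q2 yq L0 Lyq [big H0 H2 H8 H16]]]]] :=
  @parameters R d m l y lE Y1 Y2 Y3 (ltW mr).
have y_gt0 : 0 < y by apply: lt_le_trans Y2; rewrite !mulr_gt0.
rewrite -nE -Vn in big.
have qL : (q ^ L <= #|V|)%N.
  rewrite -(ler_nat R); apply: le_trans big.
  apply: (@le_trans _ _ (1 * ((d + 3) * q ^ L)%:R)).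
    by rewrite mul1r ler_nat leq_pmull// addn_gt0 orbT.
  rewrite ler_wpM2r//.
  have L1 : 1 <= L%:R ^+ 2 :> R by rewrite expr_ge1// ler1n.
  have d0 := ler0n R d.
  apply: le_trans (_ : 8 * (d%:R + 2) * 1 <= _); last by rewrite ler_wpM2l// mulr_ge0// addr_ge0.
  lra.
have le_pot : (\int[P]_w layer_time R A h w <= (potential q L y h (layer V 0))%:E)%E.
  apply: (expected_layer_time e_sym e_reg V_gt0 cdla (h := h) (Phi := potential q L y h)).
  - by move=> b; exact: potential_ge0.
  - by move=> b b'; exact: le_potential.
  - move=> b sb bh.
    exact: (potential_drop e_sym e_irr e_reg hd V_gt0 y_gt0 q2 yq L0 qL big m_gt0
      mixed H0 H2 H8 H16 sb bh).
apply: le_lt_trans le_pot _.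
(* Initially [top] is 1, so [h] layers are charged and the potential is at most
   [h * (2 * n / y + W) + W]. Since [2 * L * y < q] gives [W < n / y], and [1 <= h], this is below
   [4 * h * n / y]. *)
rewrite lte_fin /potential layer0_first_empty// h1 subSS subn0.
set W := max_fill_time R V q L.
have fW : fill_time R q L (layer V 0) <= W by exact: fill_time_le.
have q_gt0 : 0 < q%:R :> R by rewrite ltr0n; apply: leq_trans q2.
have Wy : W < n%:R / y.
  rewrite /W /max_fill_time Vn ltr_pdivlMr// mulrAC ltr_pdivrMr//.
  rewrite (_ : 2 * n%:R * L%:R * y = n%:R * (2 * L%:R * y)); last by ring.
  by rewrite ltr_pM2l.
have W0 : 0 <= W by exact: max_fill_time_ge0.
have hR : 1 <= h%:R :> R by rewrite ler1n.
rewrite Vn; rewrite (_ : 4 * h%:R * n%:R / y = h%:R * (4 * (n%:R / y))); last by ring.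
rewrite (_ : 2 * n%:R / y = 2 * (n%:R / y)); last by ring.
move: (n%:R / y) W W0 Wy fW => x W W0 Wy fW.
apply: (@le_lt_trans _ _ (h%:R * (2 * x + 2 * W))).
  have : W <= h%:R * W by rewrite ler_peMl.
  by move: (fill_time _ _ _ _) fW => f fW; nra.
rewrite ltr_pM2l; lra.
Qed.
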